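(* Let the functions $f$ and $g^r$, $r=1,\ldots,m$, be admissible (as defined in the context) with constants $L\in(0,\infty)$, $q\in(1,\infty)$ and $\eta\in(\frac12,\infty)$. Further, let $\overline{h}\in(0,1]$ with $\overline{h}\le T$. Then, for every $\xi\in L^2(\Omega,\mathcal{F}_0,\mathbf{P};\mathbb{R}^d)$ the projected Euler-Maruyama method $(\Psi^{\mathrm{PEM}},\overline{h},\xi)$ with $\alpha=\frac{1}{2(q-1)}$ is stochastically C-stable.
   Context: Let $d,m\in\mathbb{N}$, $T\in(0,\infty)$, and let $(\Omega,\mathcal{F},(\mathcal{F}_t)_{t\in[0,T]},\mathbf{P})$ be a filtered probability space satisfying the usual conditions, with independent real-valued standard $(\mathcal{F}_t)$-Brownian motions $W^1,\ldots,W^m$. $|\cdot|$ and $\langle\cdot,\cdot\rangle$ are the Euclidean norm and inner product; $\|Y\|_{L^p(\Omega;\mathbb{R}^d)}=(\mathbb{E}|Y|^p)^{1/p}$. Admissible: $f,g^r\colon[0,T]\times\mathbb{R}^d\to\mathbb{R}^d$, $r=1,\ldots,m$, are admissible with constants $L>0$, $\eta\in(\frac12,\infty)$, $q\in(1,\infty)$ if they are continuous and for all $t,t_1,t_2\in[0,T]$, $x,x_1,x_2\in\mathbb{R}^d$ and $r=1,\ldots,m$: $\langle f(t,x_1)-f(t,x_2),x_1-x_2\rangle+\eta\sum_{r=1}^m|g^r(t,x_1)-g^r(t,x_2)|^2\le L|x_1-x_2|^2$; $|f(t,x)|\vee|g^r(t,x)|\le L(1+|x|^q)$; $|f(t_1,x)-f(t_2,x)|\vee|g^r(t_1,x)-g^r(t_2,x)|\le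 L(1+|x|^q)|t_1-t_2|^{1/2}$; $|f(t,x_1)-f(t,x_2)|\vee|g^r(t,x_1)-g^r(t,x_2)|\le L(1+|x_1|^{q-1}+|x_2|^{q-1})|x_1-x_2|$. Let $\mathbb{T}:=\{(t,\delta)\in[0,T)\times(0,\overline{h}]:t+\delta\le T\}$. PEM one-step map: for $x\in\mathbb{R}^d$, $(t,\delta)\in\mathbb{T}$, put $x^\circ:=\min(1,\delta^{-\alpha}|x|^{-1})x$ (so $0^\circ=0$) and $\Psi^{\mathrm{PEM}}(x,t,\delta)=x^\circ+\delta f(t,x^\circ)+\sum_{r=1}^m g^r(t,x^\circ)(W^r(t+\delta)-W^r(t))$. A stochastic one-step method $(\Psi,\overline{h},\xi)$ is called stochastically C-stable if there exist a constant $C_{\mathrm{stab}}$ and a parameter value $\eta'\in(1,\infty)$ such that for all $(t,\delta)\in\mathbb{T}$ and all $Y,Z\in L^2(\Omega,\mathcal{F}_t,\mathbf{P};\mathbb{R}^d)$: $$\|\mathbb{E}[\Psi(Y,t,\delta)-\Psi(Z,t,\delta)|\mathcal{F}_t]\|_{L^2(\Omega;\mathbb{R}^d)}^2+\eta'\|(\mathrm{id}-\mathbb{E}[\,\cdot\,|\mathcal{F}_t])(\Psi(Y,t,\delta)-\Psi(Z,t,\delta))\|_{L^2(\Omega;\mathbb{R}^d)}^2\le(1+C_{\mathrm{stab}}\delta)\|Y-Z\|_{L^2(\Omega;\mathbb{R}^d)}^2,$$ where $(\mathrm{id}-\mathbb{E}[\,\cdot\,|\mathcal{F}_t])V:=V-\mathbb{E}[V|\mathcal{F}_t]$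 and $\Psi(Z,t,\delta)$ is the random variable $\omega\mapsto\Psi(Z(\omega),t,\delta,\omega)$. (Being a stochastic one-step method means: $\xi\in L^2(\Omega,\mathcal{F}_0,\mathbf{P};\mathbb{R}^d)$ and $\Psi(Z,t,\delta)\in L^2(\Omega,\mathcal{F}_{t+\delta},\mathbf{P};\mathbb{R}^d)$ for all $(t,\delta)\in\mathbb{T}$, $Z\in L^2(\Omega,\mathcal{F}_t,\mathbf{P};\mathbb{R}^d)$.) *)

(* Defs.v *)
From HB Require Import structures.
From mathcomp Require Import all_boot all_order all_algebra.
From mathcomp Require Import all_classical all_reals all_analysis.
From mathcomp Require Import measurable_realfun.

Set Implicit Arguments.
Unset Strict Implicit.
Unset Printing Implicit Defensive.

Import Order.TTheory GRing.Theory Num.Theory.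
Import numFieldNormedType.Exports.

Local Open Scope classical_set_scope.
Local Open Scope ring_scope.

(* R^d is 'rV[R]_d.  The norm `|x| that the library puts on 'rV[R]_d is the
   maximum norm (it is only used here through the topology it induces), whence
   the Euclidean structure below. *)
Section euclidean.
Context {R : realType} {d : nat}.
Implicit Types x y : 'rV[R]_d.

Definition edot x y : R := \sum_(i < d) x 0 i * y 0 i.

Definition enorm x : R := Num.sqrt (\sum_(i < d) x 0 i ^+ 2).

End euclidean.

(* Sub-sigma-algebras of Omega are represented by their sets of events. *)
Section sub_sigma_algebras.
Context {disp : measure_display} {Omega : measurableType disp} {R : realType}.
Variable P : probability Omega R.
Implicit Types (G : set (set Omega)) (X : Omega -> R).

Definition sub_sigma_algebra_of_measurable G :=
  sigma_algebra [set: Omega] G /\ G `<=` measurable.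

(* When G is a sigma-algebra, the measurable sets of g_sigma_algebraType G are
   exactly the elements of G. *)
Definition measurable_wrt G X :=
  measurable_fun [set: g_sigma_algebraType G] (X : g_sigma_algebraType G -> R).

(* R^d is equipped with its Borel sigma-algebra. *)
Definition vmeasurable_wrt {d : nat} G (Y : Omega -> 'rV[R]_d) :=
  measurable_fun [set: g_sigma_algebraType G]
    (Y : g_sigma_algebraType G -> g_sigma_algebraType (@open 'rV[R]_d)).

Definition L2norm {d : nat} (Y : Omega -> 'rV[R]_d) : \bar R :=
  'N[P]_(2%:E)[EFin \o (enorm \o Y)]%E.

(* Random vectors, not classes modulo almost sure equality. *)
Definition L2 {d : nat} G : set (Omega -> 'rV[R]_d) :=
  [set Y | vmeasurable_wrt G Y /\ (L2norm Y < +oo)%E].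

Definition is_cond_exp G X (Y : Omega -> R) :=
  [/\ measurable_wrt G Y,
      P.-integrable [set: Omega] (EFin \o Y) &
      forall A, G A -> (\int[P]_(w in A) (Y w)%:E = \int[P]_(w in A) (X w)%:E)%E].

(* A version of E[X | G].  By cond_expP the default value 0 is not used when X is
   integrable and G is a sub-sigma-algebra. *)
Definition cond_exp G X : Omega -> R := xget (cst 0) [set Y | is_cond_exp G X Y].

Definition vcond_exp {d : nat} G (V : Omega -> 'rV[R]_d) : Omega -> 'rV[R]_d :=
  fun w => \row_i cond_exp G (fun w' => V w' 0 i) w.

Lemma cond_expP G X : sub_sigma_algebra_of_measurable G ->
  P.-integrable [set: Omega] (EFin \o X) -> is_cond_exp G X (cond_exp G X).
Proof.
move=> [sG Gm] iX.
have GE (A : set (g_sigma_algebraType G)) : measurable A = G A.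
  by exact: (congr1 (@^~ A) (sigma_algebra_id sG)).
have mid : measurable_fun [set: Omega] (idfun : Omega -> g_sigma_algebraType G).
  by move=> _ A mA; rewrite setTI preimage_id; apply: Gm; rewrite -GE.
pose phi : {mfun Omega >-> g_sigma_algebraType G} :=
  HB.pack (idfun : Omega -> g_sigma_algebraType G)
    (isMeasurableFun.Build _ _ _ _ _ mid).
pose nu A := (\int[P]_(w in A) (X w)%:E)%E.
have nu0 : nu set0 = 0%E by rewrite /nu integral_set0.
have nufin A : measurable (A : set (g_sigma_algebraType G)) -> nu A \is a fin_num.
  rewrite GE => GA.
  apply: integrable_fin_num; first exact: Gm.
  by apply: integrableS iX => //; exact: Gm.
have nusigma : semi_sigma_additive (nu : set (g_sigma_algebraType G) -> \bar R).
  have := @charge_semi_sigma_additive _ _ _ (induced_charge iX).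
  move=> cs A mA tA mUA; apply: cs => // [i|].
    by have := mA i; rewrite GE => /Gm.
  by have := mUA; rewrite GE => /Gm.
pose nuc : {charge set (g_sigma_algebraType G) -> \bar R} :=
  HB.pack (nu : set (g_sigma_algebraType G) -> \bar R)
    (isCharge.Build _ _ _ (nu : set (g_sigma_algebraType G) -> \bar R) nu0 nufin nusigma).
pose mu : probability (g_sigma_algebraType G) R := distribution P phi.
have dom : nuc `<< mu.
  apply/null_content_dominatesP => A mA muA0.
  have mA' : measurable (A : set Omega).
    by have := mA; rewrite GE => /Gm.
  rewrite /= /nu; apply: null_set_integral => //.
  exact: measurable_funS (measurable_int _ iX).
pose D : g_sigma_algebraType G -> \bar R := Radon_Nikodym nuc mu.
have iD : mu.-integrable [set: g_sigma_algebraType G] D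
  by exact: Radon_Nikodym_integrable.
have Dfin x : D x \is a fin_num by exact: Radon_Nikodym_fin_num.
have mD : measurable_fun setT D by exact: measurable_int iD.
have DE : (fun w => (fine (D w))%:E) = D by apply/funext => w; rewrite fineK.
have iDP : P.-integrable [set: Omega] (D : Omega -> \bar R).
  apply/integrableP; split; first exact: (measurableT_comp mD mid).
  have /integrableP[_] := iD.
  by rewrite /mu ge0_integral_distribution//; exact: measurableT_comp.
suff : is_cond_exp G X (fine \o D : Omega -> R) by move=> /(xgetI (cst 0)).
split.
- exact: measurableT_comp.
- by rewrite /comp DE.
- move=> A GA.
  have mA : measurable (A : set (g_sigma_algebraType G)).
    by rewrite GE.
  rewrite /= [X in integral _ _ X]DE -/(nu A).
  rewrite -[nu A]/(nuc A) (Radon_Nikodym_integral dom mA).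
  rewrite [RHS](@integral_pushforward _ _ _ _ _ phi)//.
  by apply: integrableS iDP => //; exact: Gm.
Qed.

Definition independent_event_classes (I : finType) (C : I -> set (set Omega)) :=
  forall (J : {set I}) (A : I -> set Omega), (forall i, i \in J -> C i (A i)) ->
    P (\bigcap_(i in [set i | i \in J]) A i) = (\prod_(i in J) P (A i))%E.

(* Filtrations are indexed by [0, T]; their values outside [0, T] are junk. *)
Definition filtration (T : R) (F : R -> set (set Omega)) :=
  (forall t : R, 0 <= t <= T -> sub_sigma_algebra_of_measurable (F t)) /\
  (forall s t : R, 0 <= s -> s <= t -> t <= T -> F s `<=` F t).

(* P.-negligible sets are the subsets of measurable null sets, so that the first
   condition contains the completeness of (Omega, F, P). *)
Definition usual_conditions (T : R) (F : R -> set (set Omega)) :=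
  (forall N, P.-negligible N -> F 0 N) /\
  (forall t : R, 0 <= t < T -> \bigcap_(s in `]t, T]) F s = F t).

Definition sigma_algebra_of_process (T : R) (X : R -> Omega -> R) : set (set Omega) :=
  <<s \bigcup_(t in `[0, T]) preimage_set_system [set: Omega] (X t) measurable >>.

Definition increment (W : R -> Omega -> R) (s t : R) : Omega -> R :=
  fun w => W t w - W s w.

Record standard_brownian_motion (T : R) (F : R -> set (set Omega))
    (W : R -> Omega -> R) : Prop := {
  bm_adapted : forall t : R, 0 <= t <= T -> measurable_wrt (F t) (W t);
  bm_start : {ae P, forall w, W 0 w = 0};
  bm_continuous : {ae P, forall w, {within `[0, T], continuous (fun t => W t w)}};
  (* the second parameter of normal_prob is the standard deviation *)
  bm_gaussian : forall s t : R, 0 <= s -> s < t -> t <= T ->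
    forall B : set R, measurable B ->
      P (increment W s t @^-1` B) = normal_prob 0 (Num.sqrt (t - s)) B;
  bm_independent : forall s t : R, 0 <= s -> s < t -> t <= T ->
    forall (A : set Omega) (B : set R), F s A -> measurable B ->
      P (A `&` increment W s t @^-1` B) = (P A * P (increment W s t @^-1` B))%E
}.

Definition independent_brownian_motions (T : R) (F : R -> set (set Omega)) (m : nat)
    (W : 'I_m -> R -> Omega -> R) :=
  (forall r, standard_brownian_motion T F (W r)) /\
  independent_event_classes (fun r => sigma_algebra_of_process T (W r)).

End sub_sigma_algebras.

Section admissible.
Context {R : realType} {d m : nat}.

Record admissible (T L eta q : R) (f : R -> 'rV[R]_d -> 'rV[R]_d)
    (g : 'I_m -> R -> 'rV[R]_d -> 'rV[R]_d) : Prop := {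
  adm_continuous_f : {within `[0, T] `*` [set: 'rV[R]_d],
    continuous (fun p : R * 'rV[R]_d => f p.1 p.2)};
  adm_continuous_g : forall r, {within `[0, T] `*` [set: 'rV[R]_d],
    continuous (fun p : R * 'rV[R]_d => g r p.1 p.2)};
  adm_monotone : forall (t : R) x1 x2, 0 <= t <= T ->
    edot (f t x1 - f t x2) (x1 - x2)
      + eta * \sum_(r < m) enorm (g r t x1 - g r t x2) ^+ 2
    <= L * enorm (x1 - x2) ^+ 2;
  adm_growth : forall r (t : R) x, 0 <= t <= T ->
    Num.max (enorm (f t x)) (enorm (g r t x)) <= L * (1 + enorm x `^ q);
  adm_time : forall r (t1 t2 : R) x, 0 <= t1 <= T -> 0 <= t2 <= T ->
    Num.max (enorm (f t1 x - f t2 x)) (enorm (g r t1 x - g r t2 x))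
    <= L * (1 + enorm x `^ q) * `|t1 - t2| `^ 2^-1;
  adm_space : forall r (t : R) x1 x2, 0 <= t <= T ->
    Num.max (enorm (f t x1 - f t x2)) (enorm (g r t x1 - g r t x2))
    <= L * (1 + enorm x1 `^ (q - 1) + enorm x2 `^ (q - 1)) * enorm (x1 - x2)
}.

End admissible.

Section one_step_methods.
Context {disp : measure_display} {Omega : measurableType disp} {R : realType}.
Variables (P : probability Omega R) (T : R) (F : R -> set (set Omega)).

Definition time_steps (h : R) : set (R * R) :=
  [set p | [/\ 0 <= p.1 < T, 0 < p.2 <= h & p.1 + p.2 <= T]].

(* The random variable Psi (Z, t, delta). *)
Definition eval_step {d : nat} (Psi : 'rV[R]_d -> R -> R -> Omega -> 'rV[R]_d)
    (Z : Omega -> 'rV[R]_d) (t delta : R) : Omega -> 'rV[R]_d :=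
  fun w => Psi (Z w) t delta w.

Definition stochastic_one_step_method {d : nat}
    (Psi : 'rV[R]_d -> R -> R -> Omega -> 'rV[R]_d) (h : R)
    (xi : Omega -> 'rV[R]_d) :=
  L2 P (F 0) xi /\
  forall t delta, time_steps h (t, delta) ->
    forall Z, L2 P (F t) Z -> L2 P (F (t + delta)) (eval_step Psi Z t delta).

Definition stochastically_C_stable {d : nat}
    (Psi : 'rV[R]_d -> R -> R -> Omega -> 'rV[R]_d) (h : R)
    (xi : Omega -> 'rV[R]_d) :=
  stochastic_one_step_method Psi h xi /\
  exists C_stab eta' : R, 1 < eta' /\
    forall t delta, time_steps h (t, delta) ->
      forall Y Z, L2 P (F t) Y -> L2 P (F t) Z ->
        let D : Omega -> 'rV[R]_d :=
          fun w => eval_step Psi Y t delta w - eval_step Psi Z t delta w in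
        let E := vcond_exp P (F t) D in
        (L2norm P E ^+ 2 + eta'%:E * L2norm P (fun w => (D w - E w)%R) ^+ 2
          <= (1 + C_stab * delta)%R%:E * L2norm P (fun w => (Y w - Z w)%R) ^+ 2)%E.

End one_step_methods.

Section projected_euler_maruyama.
Context {disp : measure_display} {Omega : measurableType disp} {R : realType}.
Context {d m : nat}.

(* 0^-1 = 0 in MathComp, hence projection alpha delta 0 = 0. *)
Definition projection (alpha delta : R) (x : 'rV[R]_d) : 'rV[R]_d :=
  Num.min 1 (delta `^ (- alpha) * (enorm x)^-1) *: x.

Definition PEM (W : 'I_m -> R -> Omega -> R) (alpha : R)
    (f : R -> 'rV[R]_d -> 'rV[R]_d) (g : 'I_m -> R -> 'rV[R]_d -> 'rV[R]_d)
    (x : 'rV[R]_d) (t delta : R) (w : Omega) : 'rV[R]_d :=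
  let x' := projection alpha delta x in
  x' + delta *: f t x' + \sum_(r < m) (W r (t + delta) w - W r t w) *: g r t x'.

End projected_euler_maruyama.

(* Main.v *)
Require Import Defs.
From HB Require Import structures.
From mathcomp Require Import all_boot all_order all_algebra.
From mathcomp Require Import all_classical all_reals all_analysis.
From mathcomp Require Import measurable_realfun.
From mathcomp Require Import ring lra.

(** The projection sends every state into the ball of radius
    [delta `^ (- alpha)], where the polynomial growth conditions turn the
    coefficients of the step into bounded Lipschitz functions of the state. So the
    difference of two steps, started at [Y] and [Z], is [A + N], with a bounded part
    [A] known at time [t] and a sum [N] of Brownian increments with bounded
    coefficients [B r] known at time [t].

    The noise [N] is orthogonal to the past, hence [A] is the conditional expectation
    of the difference, and the squared norm of [N] is at most [delta] times the sum
    of those of the [B r] ([integral_past_stochastic_sum],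
    [stochastic_sum_sqr_moment]). What remains is an inequality between the
    coefficients at two points ([pem_one_step_estimate]): with [eta' = 2 * eta] the
    monotonicity condition absorbs both the noise and the cross term of the
    drift, the choice of [alpha] makes the square of the drift of order [delta], and
    the projection is nonexpansive. The stability constant is
    [2 * L + 9 * L ^+ 2].

    The squared norm of [N] needs increments of distinct motions to be uncorrelated
    conditionally on the past ([integral_cross_increments]), although the
    motions are only known to be independent of each other, and each one to have
    increments independent of the past. The product of two increments over the step
    is split along a subdivision into [n] parts. The products over different parts
    have conditional expectation zero, since the later increment is independent
    of everything before it. The products over equal parts are orthogonal by
    independence of the motions, so that their sum has squared norm at most
    [delta ^+ 2 / n], which tends to zero.

    The moments of the Gaussian increments come from comparing normal densities of
    different means and variances ([gaussian_sqr_moment], [gaussian_centered]), and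
    expectations of products of independent variables from Fubini's theorem. *)

Set Implicit Arguments.
Unset Strict Implicit.
Unset Printing Implicit Defensive.

Import Order.TTheory GRing.Theory Num.Theory.
Import numFieldNormedType.Exports.

Local Open Scope classical_set_scope.
Local Open Scope ring_scope.

(** * Euclidean geometry and the projection onto a ball *)

Section euclidean_space.
Context {R : realType} {d : nat}.
Implicit Types (x y z : 'rV[R]_d) (a b : R).

Lemma edotC x y : edot x y = edot y x.
Proof. by apply: eq_bigr => i _; rewrite mulrC. Qed.

Lemma edotDl x y z : edot (x + y) z = edot x z + edot y z.
Proof. by rewrite -big_split; apply: eq_bigr => i _; rewrite !mxE mulrDl. Qed.

Lemma edotZl a x y : edot (a *: x) y = a * edot x y.
Proof. by rewrite mulr_sumr; apply: eq_bigr => i _; rewrite !mxE mulrA. Qed.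

Lemma edotDr x y z : edot z (x + y) = edot z x + edot z y.
Proof. by rewrite !(edotC z) edotDl. Qed.

Lemma edotZr a x y : edot y (a *: x) = a * edot y x.
Proof. by rewrite !(edotC y) edotZl. Qed.

Lemma edotNl x y : edot (- x) y = - edot x y.
Proof. by rewrite -scaleN1r edotZl mulN1r. Qed.

Lemma edotNr x y : edot y (- x) = - edot y x.
Proof. by rewrite !(edotC y) edotNl. Qed.

Definition edotE := (edotDl, edotDr, edotNl, edotNr, edotZl, edotZr).

Lemma sqr_enormE x : enorm x ^+ 2 = \sum_(i < d) x 0 i ^+ 2.
Proof. by rewrite sqr_sqrtr// sumr_ge0// => i _; exact: sqr_ge0. Qed.

Lemma sqr_enorm x : enorm x ^+ 2 = edot x x.
Proof. by rewrite sqr_enormE; apply: eq_bigr => i _; rewrite expr2. Qed.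

Lemma enorm_ge0 x : 0 <= enorm x.
Proof. exact: sqrtr_ge0. Qed.

Lemma enormZ a x : enorm (a *: x) = `|a| * enorm x.
Proof.
apply/eqP; rewrite -(@eqrXn2 _ 2)//; last 2 first.
- exact: enorm_ge0.
- by rewrite mulr_ge0// enorm_ge0.
by rewrite exprMn !sqr_enorm !edotE mulrA real_normK ?num_real// expr2.
Qed.

Lemma coord_le_enorm x i : `|x 0 i| <= enorm x.
Proof.
rewrite -ler_sqr ?nnegrE ?enorm_ge0// real_normK ?num_real// sqr_enormE.
by rewrite (bigD1 i)//= lerDl sumr_ge0// => j _; exact: sqr_ge0.
Qed.

Lemma enorm_eq0 x : (enorm x == 0) = (x == 0).
Proof.
apply/idP/idP => [/eqP x0|/eqP->].
  apply/eqP/rowP => i; rewrite mxE; apply/eqP; rewrite -normr_le0 -x0.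
  exact: coord_le_enorm.
by rewrite -(scale0r 0) enormZ normr0 mul0r.
Qed.

(** The Cauchy-Schwarz inequality, read off from the squared norm of
    [enorm y *: x - enorm x *: y]. *)
Lemma edot_le x y : edot x y <= enorm x * enorm y.
Proof.
have [/eqP x0|x0] := boolP (enorm x == 0).
  move/eqP: (x0); rewrite enorm_eq0 => /eqP ->.
  by rewrite -(scale0r 0) edotZl mul0r mulr_ge0// enorm_ge0.
have [/eqP y0|y0] := boolP (enorm y == 0).
  move/eqP: (y0); rewrite enorm_eq0 => /eqP ->.
  by rewrite -(scale0r 0) edotZr mul0r mulr_ge0// enorm_ge0.
have xy : 0 < enorm x * enorm y by rewrite mulr_gt0// lt0r ?x0 ?y0 ?enorm_ge0.
have := sqr_ge0 (enorm (enorm y *: x - enorm x *: y)).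
rewrite sqr_enorm !edotE -!sqr_enorm (edotC y x) => h.
rewrite -(ler_pM2l xy); nra.
Qed.

Lemma enormD x y : enorm (x + y) <= enorm x + enorm y.
Proof.
rewrite -ler_sqr ?nnegrE ?addr_ge0 ?enorm_ge0// sqr_enorm !edotE -!sqr_enorm.
rewrite (edotC y x) sqrrD; have := edot_le x y; lra.
Qed.

Lemma enorm_le_coords x b : 0 <= b -> (forall i, `|x 0 i| <= b) ->
  enorm x <= (d%:R + 1) * b.
Proof.
move=> b0 xb.
rewrite -ler_sqr ?nnegrE ?enorm_ge0 ?mulr_ge0 ?addr_ge0// sqr_enormE.
apply: (@le_trans _ _ (\sum_(i < d) b ^+ 2)).
  by apply: ler_sum => i _; rewrite -[leLHS]real_normK ?num_real// ler_sqr ?nnegrE.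
rewrite sumr_const card_ord -[leLHS]mulr_natl exprMn ler_wpM2r// ?sqr_ge0//.
have : (0:R) <= d%:R by []. nra.
Qed.

End euclidean_space.

Section projection_onto_ball.
Context {R : realType} {d : nat}.
Variables (alpha delta : R).
Hypothesis delta_gt0 : 0 < delta.
Implicit Types (x y : 'rV[R]_d).
Let rho := delta `^ (- alpha).
Let proj x := projection alpha delta x.

Let rho_gt0 : 0 < rho. Proof. exact: powR_gt0. Qed.

Lemma enorm_projection x : enorm (projection alpha delta x) <= delta `^ (- alpha).
Proof.
rewrite /projection enormZ -/rho.
have [->|x0] := eqVneq (enorm x) 0; first by rewrite mulr0 ltW.
have x_gt0 : 0 < enorm x by rewrite lt0r x0 enorm_ge0.
rewrite ger0_norm; last by rewrite le_min ler01 divr_ge0// ltW.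
by rewrite -ler_pdivlMr// ge_min lexx orbT.
Qed.

(** Outside the ball [x - proj x] is a nonnegative multiple of [x], and
    [<x, y> <= rho * |x| = <x, proj x>] for [y] in the ball. *)
Let proj_variational x y : enorm y <= rho ->
  edot (x - proj x) (y - proj x) <= 0.
Proof.
move=> ylt; rewrite /proj /projection -/rho.
have [/eqP|x0] := eqVneq (enorm x) 0.
  by rewrite enorm_eq0 => /eqP ->; rewrite scaler0 subr0 -(scale0r 0) edotZl mul0r.
have x_gt0 : 0 < enorm x by rewrite lt0r x0 enorm_ge0.
have [lt1|le1] := ltP 1 (rho / enorm x).
  by rewrite scale1r subrr -(scale0r 0) edotZl mul0r.
rewrite !edotE -sqr_enorm.
have e : rho / enorm x * enorm x = rho by rewrite divfK.
have xy := le_trans (edot_le x y) (ler_wpM2l (enorm_ge0 x) ylt).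
set l := rho / enorm x in le1 e *.
have l0 : 0 <= l by rewrite divr_ge0// ltW.
have -> : edot x y + - (l * enorm x ^+ 2) +
  (- (l * edot x y) - - (l * (l * enorm x ^+ 2))) =
  (1 - l) * (edot x y - rho * enorm x) by rewrite -e; ring.
rewrite mulr_ge0_le0 ?subr_ge0// subr_le0 mulrC//.
Qed.

(** Adding the variational inequalities at [x] and at [y] gives
    [|u|^2 <= <x - y, u>] for the difference [u] of the projections. *)
Lemma projection_nonexpansive x y :
  enorm (projection alpha delta x - projection alpha delta y) <= enorm (x - y).
Proof.
rewrite -ler_sqr ?nnegrE ?enorm_ge0//.
have h1 := @proj_variational x (proj y) (enorm_projection y).
have h2 := @proj_variational y (proj x) (enorm_projection x).
have := sqr_ge0 (enorm ((x - y) - (proj x - proj y))).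
rewrite -/(proj x) -/(proj y).
move: (proj x) (proj y) h1 h2 => u v; rewrite !sqr_enorm !edotE.
rewrite (edotC y x) (edotC v u) !(edotC u) !(edotC v).
lra.
Qed.

End projection_onto_ball.

(** * The coefficients of the projected step *)

Section one_step_estimate.
Context {R : realType} {d m : nat}.
Variables (T L eta q t delta : R).
Variables (f : R -> 'rV[R]_d -> 'rV[R]_d) (g : 'I_m -> R -> 'rV[R]_d -> 'rV[R]_d).
Hypotheses (m_gt0 : (0 < m)%N) (L_gt0 : 0 < L) (q_gt1 : 1 < q).
Hypotheses (adm : admissible T L eta q f g).
Hypotheses (t_in : 0 <= t <= T) (delta_gt0 : 0 < delta) (delta_le1 : delta <= 1).
Implicit Types (x y : 'rV[R]_d).
Let alpha : R := 1 / (2 * (q - 1)).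
Local Notation proj := (projection alpha delta).
Let rho := delta `^ (- alpha).

Lemma sqrt_delta_gt0 : 0 < Num.sqrt delta.
Proof. by rewrite sqrtr_gt0. Qed.

(** This bound fixes the choice of [alpha]: on the ball of radius
    [delta `^ (- alpha)] the polynomial Lipschitz constant of the coefficients is
    of order [delta `^ (- 1 / 2)]. *)
Lemma enorm_projection_powR x : enorm (proj x) `^ (q - 1) <= (Num.sqrt delta)^-1.
Proof.
have q1 : 0 < q - 1 by rewrite subr_gt0.
apply: (@le_trans _ _ (rho `^ (q - 1))).
  by rewrite ge0_ler_powR ?(ltW q1) ?nnegrE ?enorm_ge0 ?powR_ge0// enorm_projection.
rewrite /rho -powRrM /alpha.
have -> : - (1 / (2 * (q - 1))) * (q - 1) = - 2^-1 :> R by field; rewrite gt_eqF.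
by rewrite powRN powR12_sqrt// ltW.
Qed.

Lemma lipschitz_on_ball r x y :
  Num.max (enorm (f t (proj x) - f t (proj y)))
          (enorm (g r t (proj x) - g r t (proj y)))
    <= 3 * L / Num.sqrt delta * enorm (proj x - proj y).
Proof.
apply: le_trans (adm_space adm r _ _ t_in) _.
rewrite ler_wpM2r ?enorm_ge0//.
rewrite [3 * L]mulrC -mulrA ler_wpM2l ?(ltW L_gt0)//.
have hx := enorm_projection_powR x; have hy := enorm_projection_powR y.
have : 1 <= (Num.sqrt delta)^-1.
  by rewrite invf_ge1 ?sqrt_delta_gt0// -sqrtr1 ler_wsqrtr.
by lra.
Qed.

Definition pem_drift x : 'rV[R]_d := proj x + delta *: f t (proj x).
Definition pem_diffusion r x : 'rV[R]_d := g r t (proj x).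

Lemma pem_diffusion_lipschitz r x y :
  enorm (pem_diffusion r x - pem_diffusion r y)
    <= 3 * L / Num.sqrt delta * enorm (x - y).
Proof.
have := lipschitz_on_ball r x y; rewrite ge_max => /andP[_ h].
apply: le_trans h _; rewrite ler_wpM2l ?projection_nonexpansive//.
by rewrite divr_ge0 ?mulr_ge0 ?sqrtr_ge0// ltW.
Qed.

Lemma pem_drift_lipschitz x y :
  enorm (pem_drift x - pem_drift y)
    <= (1 + delta * (3 * L / Num.sqrt delta)) * enorm (x - y).
Proof.
have r : 'I_m by exact: Ordinal m_gt0.
have := lipschitz_on_ball r x y; rewrite ge_max => /andP[h _].
rewrite /pem_drift opprD addrACA -scalerBr.
apply: le_trans (enormD _ _) _; rewrite mulrDl mul1r lerD ?projection_nonexpansive//.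
rewrite enormZ gtr0_norm// -mulrA ler_wpM2l ?(ltW delta_gt0)//.
apply: le_trans h _; rewrite ler_wpM2l ?projection_nonexpansive//.
by rewrite divr_ge0 ?mulr_ge0 ?sqrtr_ge0// ltW.
Qed.

Let growth_on_ball r x : Num.max (enorm (f t (proj x))) (enorm (g r t (proj x)))
  <= L * (1 + rho `^ q).
Proof.
apply: le_trans (adm_growth adm r _ t_in) _.
rewrite ler_wpM2l ?lerD2l ?(ltW L_gt0)//.
by rewrite ge0_ler_powR ?(ltW (lt_trans ltr01 q_gt1)) ?nnegrE ?enorm_ge0
  ?powR_ge0// enorm_projection.
Qed.

Lemma pem_diffusion_bounded r : exists K, forall x, enorm (pem_diffusion r x) <= K.
Proof.
exists (L * (1 + rho `^ q)) => x.
by have := growth_on_ball r x; rewrite ge_max => /andP[].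
Qed.

Lemma pem_drift_bounded : exists K, forall x, enorm (pem_drift x) <= K.
Proof.
have r : 'I_m by exact: Ordinal m_gt0.
exists (rho + delta * (L * (1 + rho `^ q))) => x.
apply: le_trans (enormD _ _) _; apply: lerD; first exact: enorm_projection.
rewrite enormZ gtr0_norm// ler_wpM2l ?(ltW delta_gt0)//.
by have := growth_on_ball r x; rewrite ge_max => /andP[].
Qed.

(** Expand the square of the difference [u + delta *: v] of the drifts. The cross
    term [2 * delta * <u, v>] and the diffusion term of weight [2 * eta] are
    together controlled by the monotonicity condition, up to
    [2 * L * delta * |u|^2]; the term [delta^2 * |v|^2] is at most
    [9 * L^2 * delta * |u|^2] because the Lipschitz constant on the ball is of
    order [delta `^ (- 1 / 2)]. *)
Lemma pem_one_step_estimate x y :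
  enorm (pem_drift x - pem_drift y) ^+ 2
    + 2 * eta * (delta * \sum_(r < m) enorm (pem_diffusion r x - pem_diffusion r y) ^+ 2)
  <= (1 + (2 * L + 9 * L ^+ 2) * delta) * enorm (x - y) ^+ 2.
Proof.
have r : 'I_m by exact: Ordinal m_gt0.
have mono := adm_monotone adm (proj x) (proj y) t_in.
have := lipschitz_on_ball r x y; rewrite ge_max => /andP[lipf _].
have nonexp := projection_nonexpansive alpha delta_gt0 x y.
set S := \sum_(r < m) _ in mono *.
rewrite -/S /pem_drift opprD addrACA -scalerBr.
set u := proj x - proj y in mono lipf nonexp *.
set v := f t (proj x) - f t (proj y) in mono lipf *.
clearbody u v S; rewrite sqr_enorm !edotE -!sqr_enorm (edotC u v).
have lipf2 : (delta * enorm v) ^+ 2 <= 9 * L ^+ 2 * delta * enorm u ^+ 2.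
  apply: (@le_trans _ _ ((delta * (3 * L / Num.sqrt delta * enorm u)) ^+ 2)).
    by rewrite ler_sqr ?nnegrE ?mulr_ge0 ?divr_ge0 ?enorm_ge0 ?sqrtr_ge0
      ?(ltW delta_gt0) ?(ltW L_gt0)// ler_pM2l.
  have sq (D s U : R) : s != 0 -> s ^+ 2 = D ->
      (D * (3 * L / s * U)) ^+ 2 = 9 * L ^+ 2 * D * U ^+ 2.
    by move=> s0 <-; field.
  by rewrite (sq _ _ _ _ (sqr_sqrtr (ltW delta_gt0)))// gt_eqF// sqrt_delta_gt0.
have mono' : delta * (edot v u + eta * S) <= delta * (L * enorm u ^+ 2).
  by rewrite ler_pM2l.
apply: (@le_trans _ _ ((1 + (2 * L + 9 * L ^+ 2) * delta) * enorm u ^+ 2)).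
  rewrite -subr_ge0 in lipf2; rewrite -subr_ge0 in mono'; rewrite -subr_ge0.
  nra.
rewrite ler_wpM2l ?ler_sqr ?nnegrE ?enorm_ge0//.
by rewrite addr_ge0// mulr_ge0 ?addr_ge0 ?mulr_ge0 ?sqr_ge0// ltW.
Qed.

End one_step_estimate.

(** * Products of independent random variables *)

Section independence.
Context {disp : measure_display} {Omega : measurableType disp} {R : realType}.
Variable P : probability Omega R.
Implicit Types X Y : Omega -> R.

Definition independent_rv X Y := forall A B : set R, measurable A -> measurable B ->
  P (X @^-1` A `&` Y @^-1` B) = (P (X @^-1` A) * P (Y @^-1` B))%E.

Lemma independent_rv_comp X Y (phi psi : R -> R) :
  measurable_fun [set: R] phi -> measurable_fun [set: R] psi ->
  independent_rv X Y -> independent_rv (phi \o X) (psi \o Y).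
Proof.
move=> mphi mpsi indep A B mA mB; apply: (indep (phi @^-1` A) (psi @^-1` B)).
- by rewrite -[X in measurable X]setTI; exact: mphi.
- by rewrite -[X in measurable X]setTI; exact: mpsi.
Qed.

Section product_of_independent.
Variables X Y : {RV P >-> R}.
Hypothesis XY : independent_rv X Y.

Let pair_fun w := (X w, Y w).
Let measurable_pair_fun : measurable_fun [set: Omega] pair_fun.
Proof. exact: measurable_fun_pair. Qed.
HB.instance Definition _ := isMeasurableFun.Build _ _ _ _ pair_fun measurable_pair_fun.

(** The law of a pair of independent variables is the product of their laws, so
    that moments of the pair are computed by Fubini's theorem. *)
Let law_pair Z : measurable Z ->
  (distribution P X \x distribution P Y)%E Z = distribution P pair_fun Z.
Proof. by apply: product_measure_unique => A B mA mB; exact: XY. Qed.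

Lemma independent_ge0_integralM (u v : R -> \bar R) :
  measurable_fun [set: R] u -> measurable_fun [set: R] v ->
  (forall x, 0 <= u x)%E -> (forall x, 0 <= v x)%E ->
  (\int[P]_w (u (X w) * v (Y w)) = \int[P]_w u (X w) * \int[P]_w v (Y w))%E.
Proof.
move=> mu mv u0 v0.
pose f (z : R * R) := (u z.1 * v z.2)%E.
have mf : measurable_fun setT f.
  by apply: emeasurable_funM; apply: measurableT_comp.
have f0 z : (0 <= f z)%E by rewrite mule_ge0.
rewrite -[LHS](ge0_integral_distribution pair_fun mf f0).
rewrite (eq_measure_integral (distribution P X \x distribution P Y)%E); last first.
  by move=> A mA _; exact/esym/law_pair.
rewrite fubini_tonelli1// /fubini_F/f/=.
under eq_integral do rewrite ge0_integralZl//.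
rewrite ge0_integralZr//; last exact: integral_ge0.
by rewrite !ge0_integral_distribution.
Qed.

Hypotheses (iX : P.-integrable setT (EFin \o X)) (iY : P.-integrable setT (EFin \o Y)).

Lemma independent_integrableM : P.-integrable setT (EFin \o (X \* Y)).
Proof.
apply/integrableP; split; first exact/measurable_EFinP/measurable_funM.
under eq_integral do rewrite /= normrM EFinM.
have mabs : measurable_fun [set: R] (fun x : R => `|x|%:E).
  by apply/(measurable_EFinP _ (fun x : R => `|x|)); exact: normr_measurable.
rewrite (independent_ge0_integralM mabs mabs)//.
have /integrableP[_ hX] := iX; have /integrableP[_ hY] := iY.
by rewrite lte_mul_pinfty// ?integral_ge0// ge0_fin_numE// integral_ge0.
Qed.

Lemma independent_RintegralM :
  \int[P]_w (X w * Y w) = \int[P]_w X w * \int[P]_w Y w.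
Proof.
pose f (z : R * R) := ((z.1 * z.2)%:E)%E.
have mf : measurable_fun setT f.
  by apply/measurable_EFinP; apply: measurable_funM.
have ifXY : (distribution P X \x distribution P Y)%E.-integrable setT f.
  have /integrableP[_ h] := independent_integrableM.
  apply/integrableP; split => //.
  rewrite (eq_measure_integral (distribution P pair_fun)); last first.
    by move=> A mA _; exact: law_pair.
  by rewrite ge0_integral_distribution//; exact: measurableT_comp.
rewrite /Rintegral.
rewrite -[X in fine X = _](@integral_distribution _ _ _ _ _ P pair_fun f mf independent_integrableM).
rewrite (eq_measure_integral (distribution P X \x distribution P Y)%E); last first.
  by move=> A mA _; exact/esym/law_pair.
rewrite -integral12_prod_meas1// /fubini_F/f/=.
have iXE : (distribution P X).-integrable setT EFin.
  exact: integrable_pushforward.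
have iYE : (distribution P Y).-integrable setT EFin.
  exact: integrable_pushforward.
under eq_integral do (under eq_integral do rewrite EFinM; rewrite integralZl//).
rewrite -[X in integral _ _ (fun x => _ * X)%E]fineK; last exact: integrable_fin_num.
rewrite integralZr// fineM//; try exact: integrable_fin_num.
rewrite fineK; last exact: integrable_fin_num.
by rewrite !integral_distribution.
Qed.

End product_of_independent.
End independence.

(** * Square integrable variables and Gaussian moments *)

Section square_integrable.
Context {disp : measure_display} {Omega : measurableType disp} {R : realType}.
Variable P : probability Omega R.
Implicit Types X Y : Omega -> R.

Lemma Lfun2P X : X \in Lfun P 2%:E <->
  measurable_fun [set: Omega] X /\ P.-integrable setT (EFin \o (fun w => X w ^+ 2)).
Proof.
split=> [lX|[mX iX]].
  split; last exact: Lfun2_integrable_sqr.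
  by move: lX; rewrite inE => /andP[/[!inE]].
rewrite inE; apply/andP; split; rewrite inE//= /finite_norm unlock poweR_lty//.
have /integrableP[_] := iX.
apply: le_lt_trans; rewrite le_eqVlt; apply/orP; left; apply/eqP.
by apply: eq_integral => w _ /=; rewrite normrX powR_mulrn.
Qed.

Lemma Lfun2_measurable X : X \in Lfun P 2%:E -> measurable_fun [set: Omega] X.
Proof. by case/Lfun2P. Qed.

Lemma Lfun2_integrable X : X \in Lfun P 2%:E -> P.-integrable setT (EFin \o X).
Proof.
move=> lX; apply/Lfun1_integrable; apply: Lfun_subset12 lX.
by rewrite fin_num_measure.
Qed.

Lemma Lfun2_integrableM X Y : X \in Lfun P 2%:E -> Y \in Lfun P 2%:E ->
  P.-integrable setT (EFin \o (fun w => X w * Y w)).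
Proof. by move=> lX lY; apply/Lfun1_integrable/Lfun2_mul_Lfun1. Qed.

Lemma Lfun2_bounded X K : measurable_fun [set: Omega] X ->
  (forall w, `|X w| <= K) -> X \in Lfun P 2%:E.
Proof.
move=> mX XK; apply/Lfun2P; split=> //.
apply: (@le_integrable _ _ _ P setT _ _ (EFin \o cst (K ^+ 2))) => //.
- exact/measurable_EFinP/measurable_funX.
- move=> w _ /=; rewrite lee_fin normrX [leRHS]ger0_norm ?sqr_ge0//.
  have := XK w; have := normr_ge0 (X w); nra.
- exact: finite_measure_integrable_cst.
Qed.

Lemma bounded_Lfun2M X Y K : measurable_fun [set: Omega] X ->
  (forall w, `|X w| <= K) -> Y \in Lfun P 2%:E ->
  (fun w => X w * Y w) \in Lfun P 2%:E.
Proof.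
move=> mX XK /Lfun2P[mY iY]; apply/Lfun2P; split; first exact: measurable_funM.
apply: (@le_integrable _ _ _ P setT _ _ (fun w => (K ^+ 2)%:E * (Y w ^+ 2)%:E))%E => //.
- exact/measurable_EFinP/measurable_funX/measurable_funM.
- move=> w _ /=; rewrite lee_fin exprMn !ger0_norm ?(mulr_ge0 (sqr_ge0 _) (sqr_ge0 _))// ler_wpM2r ?sqr_ge0//.
  rewrite -[leLHS]real_normK ?num_real//.
  have := XK w; have := normr_ge0 (X w); nra.
- exact: integrableZl.
Qed.

Section independent.
Variables X Y : Omega -> R.
Hypothesis XY : independent_rv P X Y.

Lemma independent_integral : measurable_fun [set: Omega] X ->
  measurable_fun [set: Omega] Y ->
  P.-integrable setT (EFin \o X) -> P.-integrable setT (EFin \o Y) ->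
  P.-integrable setT (EFin \o (fun w => X w * Y w)) /\
  \int[P]_w (X w * Y w) = \int[P]_w X w * \int[P]_w Y w.
Proof.
move=> mX mY iX iY.
pose X' : {RV P >-> R} := HB.pack X (isMeasurableFun.Build _ _ _ _ _ mX).
pose Y' : {RV P >-> R} := HB.pack Y (isMeasurableFun.Build _ _ _ _ _ mY).
split; first exact: (@independent_integrableM _ _ _ P X' Y').
exact: (@independent_RintegralM _ _ _ P X' Y').
Qed.

Lemma independent_Lfun2M : X \in Lfun P 2%:E -> Y \in Lfun P 2%:E ->
  (fun w => X w * Y w) \in Lfun P 2%:E.
Proof.
move=> /Lfun2P[mX iX] /Lfun2P[mY iY]; apply/Lfun2P; split; first exact: measurable_funM.
pose X' : {RV P >-> R} :=
  HB.pack (fun w => X w ^+ 2) (isMeasurableFun.Build _ _ _ _ _ (measurable_funX 2 mX)).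
pose Y' : {RV P >-> R} :=
  HB.pack (fun w => Y w ^+ 2) (isMeasurableFun.Build _ _ _ _ _ (measurable_funX 2 mY)).
have XY2 : independent_rv P X' Y'.
  by apply: (@independent_rv_comp _ _ _ P X Y (fun x => x ^+ 2) (fun x => x ^+ 2)) => //;
    exact: exprn_measurable.
have := independent_integrableM XY2 iX iY.
by apply: eq_integrable => // w _ /=; rewrite exprMn.
Qed.

End independent.
End square_integrable.

Section normal_law.
Context {R : realType}.

(** The Radon-Nikodym derivative of [normal_prob m s] with respect to the Lebesgue
    measure is almost everywhere the density. *)
Lemma ge0_integral_normal_prob (m s : R) (u : R -> \bar R) :
  measurable_fun [set: R] u -> (forall x, 0 <= u x)%E ->
  (\int[normal_prob m s]_x u x =
   \int[lebesgue_measure]_x (u x * (normal_pdf m s x)%:E))%E.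
Proof.
move=> mu u0; have dom := normal_prob_dominates m s.
rewrite -(Radon_Nikodym_SigmaFinite.change_of_variables dom u0)//.
have mpdf : measurable_fun [set: R] (EFin \o normal_pdf m s).
  by apply/measurable_EFinP; exact: measurable_normal_pdf.
have iRN := Radon_Nikodym_SigmaFinite.f_integrable dom.
apply: ae_eq_integral => //; try apply: emeasurable_funM => //.
  exact: measurable_int iRN.
apply: ae_eqe_mul2l; apply: integral_ae_eq => // E _ mE.
by rewrite -Radon_Nikodym_SigmaFinite.f_integral.
Qed.

(** Ratios of two Gaussian densities are exponentials, so that these two
    exponential moments reduce to the fact that densities have mass one. *)
Lemma normal_prob_exp_sqr (s tau : R) : 0 < s -> 0 < tau ->
  (\int[normal_prob 0 s]_x (expR (((s ^+ 2)^-1 - (tau ^+ 2)^-1) / 2 * x ^+ 2))%:E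
   = (tau / s)%:E)%E.
Proof.
move=> s0 t0; rewrite ge0_integral_normal_prob//; last first.
  by apply/measurable_EFinP; apply: measurableT_comp => //; apply: measurable_funM.
transitivity (\int[lebesgue_measure]_x ((tau / s)%:E * (normal_pdf 0 tau x)%:E))%E.
  apply: eq_integral => x _; rewrite -!EFinM; congr EFin.
  rewrite !normal_pdfE ?gt_eqF// /normal_fun mulrCA -expRD.
  rewrite [RHS]mulrA; congr (_ * expR _); last by field; rewrite !gt_eqF.
  rewrite /normal_peak -!mulrnAr !(sqrtrM _ (sqr_ge0 _)) !sqrtr_sqr !gtr0_norm//.
  by field; rewrite !gt_eqF//= sqrtr_gt0 pmulrn_lgt0// pi_gt0.
by rewrite integralZl ?integrable_normal_pdf// integral_normal_pdf mule1.
Qed.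

Lemma normal_prob_exp_linear (s m : R) : 0 < s ->
  (\int[normal_prob 0 s]_x (expR (m * x))%:E = (expR (m ^+ 2 * s ^+ 2 / 2))%:E)%E.
Proof.
move=> s0; rewrite ge0_integral_normal_prob//; last first.
  by apply/measurable_EFinP; apply: measurableT_comp => //; apply: measurable_funM.
transitivity (\int[lebesgue_measure]_x
    ((expR (m ^+ 2 * s ^+ 2 / 2))%:E * (normal_pdf (m * s ^+ 2) s x)%:E))%E.
  apply: eq_integral => x _; rewrite -!EFinM; congr EFin.
  rewrite !normal_pdfE ?gt_eqF// /normal_fun mulrCA [RHS]mulrCA -!expRD.
  by congr (_ * expR _); field; rewrite !gt_eqF.
by rewrite integralZl ?integrable_normal_pdf// integral_normal_pdf mule1.
Qed.

End normal_law.

Section gaussian_variable.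
Context {disp : measure_display} {Omega : measurableType disp} {R : realType}.
Variables (P : probability Omega R) (X : Omega -> R) (s : R).
Hypotheses (mX : measurable_fun [set: Omega] X) (s_gt0 : 0 < s).
Hypothesis lawX : forall B : set R, measurable B -> P (X @^-1` B) = normal_prob 0 s B.

Lemma gaussian_integral (u : R -> R) : measurable_fun [set: R] u ->
  (forall x, 0 <= u x) ->
  (\int[P]_w (u (X w))%:E = \int[normal_prob 0 s]_x (u x)%:E)%E.
Proof.
move=> mu u0.
have mX' : measurable_fun [set: Omega] (X : Omega -> measurableTypeR R).
  by move=> _ B mB; exact: mX.
pose X' : {mfun Omega >-> measurableTypeR R} :=
  HB.pack (X : Omega -> measurableTypeR R) (isMeasurableFun.Build _ _ _ _ _ mX').
rewrite -[LHS](@ge0_integral_distribution _ _ _ _ _ P X' (EFin \o u))//.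
  by apply: eq_measure_integral => A mA _; exact: lawX.
exact/measurable_EFinP.
Qed.

Let exponent_gt0 (tau : R) : s < tau -> 0 < ((s ^+ 2)^-1 - (tau ^+ 2)^-1) / 2.
Proof.
move=> st; have t0 := lt_trans s_gt0 st.
rewrite divr_gt0// subr_gt0 ltf_pV2 ?posrE ?exprn_gt0//.
by rewrite ltr_sqr ?nnegrE ?(ltW s_gt0) ?(ltW t0).
Qed.

(** The inequality [1 + y <= expR y] bounds the second moment by the exponential
    moment of a multiple of the square. The integral may a priori be infinite. *)
Let sqr_moment_le (tau : R) : s < tau ->
  (1 + (((s ^+ 2)^-1 - (tau ^+ 2)^-1) / 2)%:E * \int[P]_w (X w ^+ 2)%:E
    <= (tau / s)%:E)%E.
Proof.
move=> st; have t0 := lt_trans s_gt0 st.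
rewrite -(normal_prob_exp_sqr s_gt0 t0) -gaussian_integral//; last first.
  by apply: measurableT_comp => //; apply: measurable_funM.
have := exponent_gt0 st; set e := _ / 2 => e0.
rewrite -ge0_integralZl//; last first.
- by rewrite lee_fin ltW.
- by move=> w _; rewrite lee_fin sqr_ge0.
- exact/measurable_EFinP/measurable_funX.
have -> : (1 = \int[P]_w (cst 1%E w))%E by rewrite integral_cst//= probability_setT mul1e.
rewrite -ge0_integralD//; last 2 first.
- by move=> w _; rewrite mule_ge0 ?lee_fin ?sqr_ge0 ?ltW.
- by apply/measurable_EFinP; apply: measurable_funM => //; exact: measurable_funX.
apply: ge0_le_integral => //.
- by move=> w _; rewrite adde_ge0// mule_ge0 ?lee_fin ?sqr_ge0 ?ltW.
- apply: emeasurable_funD => //.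
  by apply/measurable_EFinP; apply: measurable_funM => //; exact: measurable_funX.
- apply/measurable_EFinP; apply: measurableT_comp => //; apply: measurable_funM => //.
  exact: measurable_funX.
- by move=> w _; rewrite -EFinM -EFinD lee_fin expR_ge1Dx.
Qed.

Lemma gaussian_Lfun2 : X \in Lfun P 2%:E.
Proof.
apply/Lfun2P; split=> //; apply/integrableP; split.
  exact/measurable_EFinP/measurable_funX.
under eq_integral do rewrite /= ger0_norm ?sqr_ge0//.
(* Any value of tau above s gives finiteness. *)
have st : s < s + s by rewrite ltrDl.
have := sqr_moment_le st; have := exponent_gt0 st; set e := _ / 2 => e0.
rewrite ltey; apply: contraTneq => ->.
by rewrite gt0_muley ?lte_fin.
Qed.

(** At [tau = c * s] the bound [sqr_moment_le] says that the second moment is at most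
    [2 * c^2 / (c + 1) * s^2], which tends to [s^2] as [c] decreases to [1]. *)
Lemma gaussian_sqr_moment : \int[P]_w (X w ^+ 2) <= s ^+ 2.
Proof.
have /Lfun2P[_ iX2] := gaussian_Lfun2.
set v := Rintegral _ _ _.
have vE : (\int[P]_w (X w ^+ 2)%:E = v%:E)%E.
  by rewrite /v /Rintegral fineK//; exact: integrable_fin_num iX2.
suff bound (e : R) : 0 < e -> v <= s ^+ 2 + e by apply/ler_addgt0Pr.
move=> e0.
pose c : R := 1 + Num.min 1 (e / (3 * s ^+ 2)).
have s20 : 0 < s ^+ 2 by rewrite exprn_gt0.
have c1 : 1 < c by rewrite ltrDl lt_min ltr01 divr_gt0// mulr_gt0.
have cs : s < c * s by rewrite ltr_pMl.
have := sqr_moment_le cs; rewrite vE -EFinM -EFinD lee_fin mulfK ?gt_eqF//.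
have -> : ((s ^+ 2)^-1 - ((c * s) ^+ 2)^-1) / 2 =
  (c - 1) * ((c + 1) / (2 * c ^+ 2 * s ^+ 2)).
  by field; rewrite !gt_eqF//; lra.
move=> h.
have {}h : (c + 1) * v <= 2 * c ^+ 2 * s ^+ 2.
  have c2s2 : 0 < 2 * c ^+ 2 * s ^+ 2 by rewrite !mulr_gt0 ?exprn_gt0// (lt_trans _ c1).
  rewrite -[leRHS]mul1r -ler_pdivrMr// mulrAC -(ler_pM2l (_ : 0 < c - 1)) ?subr_gt0//.
  by rewrite mulr1 mulrA lerBrDl.
have hc : c <= 2 by rewrite -[2]/(1 + 1) lerD2l ge_min lexx.
have hce : 3 * (c - 1) * s ^+ 2 <= e.
  rewrite mulrAC -ler_pdivlMl ?mulr_gt0// mulrC /c addrAC subrr add0r.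
  by rewrite ge_min lexx orbT.
have v0 : 0 <= v by apply: Rintegral_ge0 => w _; exact: sqr_ge0.
nra.
Qed.

(** From [1 + m * X <= expR (m * X)] one gets [m * v <= m^2 * s^2] for the mean [v]
    and every small [m] of either sign; letting [m] tend to [0] leaves [v = 0]. *)
Lemma gaussian_centered : \int[P]_w X w = 0.
Proof.
have iX := Lfun2_integrable gaussian_Lfun2.
set v := Rintegral _ _ _.
have main (m : R) : m ^+ 2 * s ^+ 2 <= 1 -> m * v <= m ^+ 2 * s ^+ 2.
  move=> ms.
  have mexp : measurable_fun [set: R] (fun x => expR (m * x)).
    by apply: measurableT_comp => //; apply: measurable_funM.
  have expE : (\int[P]_w (expR (m * X w))%:E = (expR (m ^+ 2 * s ^+ 2 / 2))%:E)%E.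
    by rewrite (gaussian_integral mexp) ?normal_prob_exp_linear// => x; exact: expR_ge0.
  have iexp : P.-integrable setT (fun w => (expR (m * X w))%:E).
    apply/integrableP; split; first exact/measurable_EFinP/(measurableT_comp mexp).
    by under eq_integral do rewrite /= ger0_norm ?expR_ge0//; rewrite expE ltry.
  have i1 : P.-integrable setT (EFin \o cst 1) by exact: finite_measure_integrable_cst.
  have imX : P.-integrable setT (EFin \o (fun w => m * X w)).
    by have := integrableZl measurableT m iX.
  have h : 1 + m * v <= expR (m ^+ 2 * s ^+ 2 / 2).
    have : \int[P]_w (1 + m * X w) <= \int[P]_w expR (m * X w).
      apply: le_Rintegral => //; last by move=> w _; exact: expR_ge1Dx.
      exact: (integrableD measurableT i1 imX).
    rewrite [X in _ <= X -> _]/Rintegral expE RintegralD// RintegralZl//.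
    by rewrite Rintegral_cst//= probability_setT mul1r.
  (* Here expR u' <= 1 / (1 - u') <= 1 + 2 * u' for u' = u / 2 <= 1 / 2. *)
  set u := m ^+ 2 * s ^+ 2 in ms h *.
  have u0 : 0 <= u by rewrite mulr_ge0// sqr_ge0.
  have : expR (u / 2) * expR (- (u / 2)) = 1 by rewrite expRxMexpNx_1.
  have := expR_ge1Dx (- (u / 2)); have := expR_gt0 (u / 2).
  nra.
have [//|v0] := eqVneq v 0; exfalso.
(* Given the sign of v, an m of this size contradicts main. *)
pose a := `|v|; have a0 : 0 < a by rewrite normr_gt0.
pose m := Num.min s^-1 (a / (2 * s ^+ 2)).
have m0 : 0 < m by rewrite lt_min invr_gt0 s_gt0 divr_gt0// mulr_gt0// exprn_gt0.
have ms : m * s <= 1 by rewrite -ler_pdivlMr// div1r ge_min lexx.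
have msa : 2 * (m * s ^+ 2) <= a.
  have -> : 2 * (m * s ^+ 2) = m * (2 * s ^+ 2) by ring.
  by rewrite -ler_pdivlMr ?mulr_gt0 ?exprn_gt0// ge_min lexx orbT.
have ms2 : m ^+ 2 * s ^+ 2 <= 1.
  by rewrite -exprMn expr_le1// mulr_ge0// ltW.
have : m * a <= m ^+ 2 * s ^+ 2.
  have [v_ge0|v_lt0] := leP 0 v; first by rewrite /a ger0_norm// main.
  by rewrite /a ltr0_norm// mulrN -mulNr -(sqrrN m) main// sqrrN.
rewrite expr2 -mulrA ler_pM2l// => mam.
have : 0 < m * s ^+ 2 by rewrite mulr_gt0// exprn_gt0.
lra.
Qed.

End gaussian_variable.

Section square_integrable_sums.
Context {disp : measure_display} {Omega : measurableType disp} {R : realType}.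
Variable P : probability Omega R.
Implicit Types X Y : Omega -> R.

Lemma Lfun2D X Y : X \in Lfun P 2%:E -> Y \in Lfun P 2%:E ->
  (fun w => X w + Y w) \in Lfun P 2%:E.
Proof.
move=> lX lY; have [mX iX] := (Lfun2P P X).1 lX; have [mY iY] := (Lfun2P P Y).1 lY.
apply/Lfun2P; split; first exact: measurable_funD.
have iXY := integrableZl measurableT 2 (Lfun2_integrableM lX lY).
have := integrableD measurableT (integrableD measurableT iX iXY) iY.
apply: eq_integrable => // w _ /=; rewrite -EFinM -!EFinD; congr EFin; ring.
Qed.

Lemma Lfun2_sum (I : Type) (s : seq I) (X : I -> Omega -> R) :
  (forall i, X i \in Lfun P 2%:E) ->
  (fun w => \sum_(i <- s) X i w) \in Lfun P 2%:E.
Proof.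
move=> lX; elim: s => [|i s IH].
  by under eq_fun do rewrite big_nil; exact: (Lfun_cst P 0).
by under eq_fun do rewrite big_cons; exact: Lfun2D.
Qed.

Lemma Rintegral_sum (I : Type) (s : seq I) (X : I -> Omega -> R) :
  (forall i, P.-integrable setT (EFin \o X i)) ->
  \int[P]_w (\sum_(i <- s) X i w) = \sum_(i <- s) \int[P]_w X i w.
Proof.
move=> iX; rewrite /Rintegral.
under eq_integral do rewrite -sumEFin.
rewrite integral_sum// sum_fine// => i _; exact: integrable_fin_num (iX i).
Qed.

Lemma integrable_Rsum (I : Type) (s : seq I) (X : I -> Omega -> R) :
  (forall i, P.-integrable setT (EFin \o X i)) ->
  P.-integrable setT (EFin \o (fun w => \sum_(i <- s) X i w)).
Proof.
move=> iX; have := @integrable_sum _ _ _ P setT measurableT _ s xpredT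
  (fun i => EFin \o X i) (fun i _ => iX i).
by apply: eq_integrable => // w _; rewrite /= sumEFin.
Qed.

End square_integrable_sums.

(** * Brownian increments *)

Section sub_sigma_algebra.
Context {disp : measure_display} {Omega : measurableType disp} {R : realType}.
Implicit Types (G : set (set Omega)).

Lemma measurable_wrtP G (X : Omega -> R) : sigma_algebra [set: Omega] G ->
  measurable_wrt G X <-> forall B, measurable B -> G (X @^-1` B).
Proof.
move=> sG.
have GE (A : set (g_sigma_algebraType G)) : measurable A = G A.
  by exact: (congr1 (@^~ A) (sigma_algebra_id sG)).
split=> [mX B mB|mX _ B mB].
  by rewrite -GE -[X in measurable X]setTI; exact: mX.
by rewrite setTI GE; exact: mX.
Qed.

Lemma measurable_wrt_measurable G (X : Omega -> R) :
  sub_sigma_algebra_of_measurable G -> measurable_wrt G X ->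
  measurable_fun [set: Omega] X.
Proof.
move=> [sG Gm] /(measurable_wrtP _ sG) mX _ B mB; rewrite setTI.
exact/Gm/mX.
Qed.

Lemma measurable_wrtS G H (X : Omega -> R) : sigma_algebra [set: Omega] G ->
  sigma_algebra [set: Omega] H -> G `<=` H -> measurable_wrt G X -> measurable_wrt H X.
Proof.
move=> sG sH GH /(measurable_wrtP _ sG) mX; apply/(measurable_wrtP _ sH) => B mB.
exact/GH/mX.
Qed.

End sub_sigma_algebra.

Section brownian_increment.
Context {disp : measure_display} {Omega : measurableType disp} {R : realType}.
Variables (P : probability Omega R) (T : R) (F : R -> set (set Omega)).
Variable (W : R -> Omega -> R).
Hypotheses (filtr : filtration T F) (BM : standard_brownian_motion P T F W).

Lemma filtration_sub_sigma_algebra t : 0 <= t <= T ->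
  sub_sigma_algebra_of_measurable (F t).
Proof. by have [+ _] := filtr; apply. Qed.

Lemma measurable_wrt_filtration a b (X : Omega -> R) : 0 <= a -> a <= b -> b <= T ->
  measurable_wrt (F a) X -> measurable_wrt (F b) X.
Proof.
move=> a0 ab bT; apply: measurable_wrtS.
- by have [] : sub_sigma_algebra_of_measurable (F a)
    by apply: filtration_sub_sigma_algebra; rewrite a0 (le_trans ab).
- by have [] : sub_sigma_algebra_of_measurable (F b)
    by apply: filtration_sub_sigma_algebra; rewrite (le_trans a0 ab).
- by have [_] := filtr; apply.
Qed.

Lemma increment_adapted a b : 0 <= a -> a <= b -> b <= T ->
  measurable_wrt (F b) (increment W a b).
Proof.
move=> a0 ab bT; apply: measurable_funB.
  by apply: (bm_adapted BM); rewrite (le_trans a0 ab).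
apply: measurable_wrt_filtration (bm_adapted BM _) => //.
by rewrite a0 (le_trans ab).
Qed.

Lemma increment_measurable a b : 0 <= a -> a <= b -> b <= T ->
  measurable_fun [set: Omega] (increment W a b).
Proof.
move=> a0 ab bT; apply: measurable_wrt_measurable (increment_adapted a0 ab bT).
by apply: filtration_sub_sigma_algebra; rewrite (le_trans a0 ab).
Qed.

Let law a b : 0 <= a -> a < b -> b <= T -> forall B : set R, measurable B ->
  P (increment W a b @^-1` B) = normal_prob 0 (Num.sqrt (b - a)) B.
Proof. exact: (bm_gaussian BM). Qed.

Lemma increment_Lfun2 a b : 0 <= a -> a <= b -> b <= T ->
  increment W a b \in Lfun P 2%:E.
Proof.
move=> a0 ab bT; have [<-|neq] := eqVneq a b.
  rewrite (_ : increment W a a = cst 0) ?Lfun_cst//.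
  by apply/funext => w; rewrite /increment subrr.
have {}ab : a < b by rewrite lt_neqAle neq.
apply: (gaussian_Lfun2 (increment_measurable a0 (ltW ab) bT) _ (law a0 ab bT)).
by rewrite sqrtr_gt0 subr_gt0.
Qed.

Lemma increment_centered a b : 0 <= a -> a < b -> b <= T ->
  \int[P]_w increment W a b w = 0.
Proof.
move=> a0 ab bT.
apply: (gaussian_centered (increment_measurable a0 (ltW ab) bT) _ (law a0 ab bT)).
by rewrite sqrtr_gt0 subr_gt0.
Qed.

Lemma increment_sqr_moment a b : 0 <= a -> a < b -> b <= T ->
  \int[P]_w (increment W a b w ^+ 2) <= b - a.
Proof.
move=> a0 ab bT; have ba : 0 < b - a by rewrite subr_gt0.
rewrite -[leRHS](sqr_sqrtr (ltW ba)).
apply: (gaussian_sqr_moment (increment_measurable a0 (ltW ab) bT) _ (law a0 ab bT)).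
by rewrite sqrtr_gt0.
Qed.

Lemma increment_independent a b (X : Omega -> R) : 0 <= a -> a < b -> b <= T ->
  measurable_wrt (F a) X -> independent_rv P X (increment W a b).
Proof.
move=> a0 ab bT mX A B mA mB; apply: (bm_independent BM) => //.
have aT : 0 <= a <= T by rewrite a0 (le_trans (ltW ab)).
by have [sF _] := filtration_sub_sigma_algebra aT; apply: (measurable_wrtP _ sF).1.
Qed.

Lemma integral_past_increment a b (X : Omega -> R) : 0 <= a -> a < b -> b <= T ->
  measurable_wrt (F a) X -> X \in Lfun P 2%:E ->
  \int[P]_w (X w * increment W a b w) = 0.
Proof.
move=> a0 ab bT mX lX; have lW := increment_Lfun2 a0 (ltW ab) bT.
have [_ ->] := independent_integral (increment_independent a0 ab bT mX)
  (Lfun2_measurable lX) (Lfun2_measurable lW) (Lfun2_integrable lX) (Lfun2_integrable lW).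
by rewrite increment_centered// mulr0.
Qed.

Lemma increment_measurable_process a b : 0 <= a <= T -> 0 <= b <= T ->
  measurable_wrt (sigma_algebra_of_process T W) (increment W a b).
Proof.
move=> a0T b0T.
have mW u : 0 <= u <= T -> measurable_wrt (sigma_algebra_of_process T W) (W u).
  move=> u0T; apply/measurable_wrtP; first exact: smallest_sigma_algebra.
  move=> B mB; apply: sub_sigma_algebra; exists u; first by rewrite /= in_itv.
  by exists B => //; rewrite setTI.
by apply: measurable_funB; exact: mW.
Qed.

End brownian_increment.

(** * Increments of distinct Brownian motions *)

Section brownian_family.
Context {disp : measure_display} {Omega : measurableType disp} {R : realType}.
Variables (P : probability Omega R) (T : R) (F : R -> set (set Omega)).
Variables (m : nat) (W : 'I_m -> R -> Omega -> R).
Hypotheses (filtr : filtration T F) (BM : independent_brownian_motions P T F W).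

Let bm r : standard_brownian_motion P T F (W r). Proof. by case: BM. Qed.

Lemma processes_independent r s (X Y : Omega -> R) : r != s ->
  measurable_wrt (sigma_algebra_of_process T (W r)) X ->
  measurable_wrt (sigma_algebra_of_process T (W s)) Y -> independent_rv P X Y.
Proof.
move=> rs mX mY A B mA mB; have [_ indep] := BM.
have sG u : sigma_algebra [set: Omega] (sigma_algebra_of_process T (W u)).
  exact: smallest_sigma_algebra.
pose C u := if u == r then X @^-1` A else Y @^-1` B.
have sr : (s == r) = false by rewrite eq_sym (negbTE rs).
have := indep [set r; s]%SET C.
have -> : (\prod_(i in [set r; s]%SET) P (C i) = P (X @^-1` A) * P (Y @^-1` B))%E.
  by rewrite big_setU1 ?inE// big_set1 /C eqxx sr.
move=> <-.
  congr (P _); apply/seteqP; split => w /=.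
    move=> [Xw Yw] i /=; rewrite !inE => /orP[|] /eqP ->.
      by rewrite /C eqxx.
    by rewrite /C sr.
  move=> Cw; split.
    by have := Cw r; rewrite /= !inE /C eqxx; apply.
  by have := Cw s; rewrite /= !inE /C eqxx orbT sr; apply.
move=> i; rewrite !inE => /orP[|] /eqP ->; rewrite /C ?eqxx ?sr.
  exact: (measurable_wrtP _ (sG r)).1.
exact: (measurable_wrtP _ (sG s)).1.
Qed.

Section cross_moment.
Variables (r s : 'I_m) (t delta : R) (c : Omega -> R) (K : R).
Hypotheses (rs : r != s) (t_ge0 : 0 <= t) (delta_gt0 : 0 < delta) (tT : t + delta <= T).
Hypotheses (mc : measurable_wrt (F t) c) (cK : forall w, `|c w| <= K).

Let t_in : 0 <= t <= T.
Proof. by rewrite t_ge0 (le_trans _ tT)// lerDl ltW. Qed.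

Let mc' : measurable_fun [set: Omega] c.
Proof.
exact: measurable_wrt_measurable (filtration_sub_sigma_algebra filtr t_in) mc.
Qed.

Section subdivision.
Variable n : nat.
Let step : R := delta / n.+1%:R.
Let tau (i : nat) : R := t + i%:R * step.
Let X i := increment (W r) (tau i) (tau i.+1).
Let Y i := increment (W s) (tau i) (tau i.+1).
Let Z i w := X i w * Y i w.
Let S (k : nat) w := \sum_(i < k) Z i w.

Let step_gt0 : 0 < step. Proof. by rewrite divr_gt0. Qed.

Let tauS i : tau i.+1 = tau i + step.
Proof. by rewrite /tau -natr1 mulrDl mul1r addrA. Qed.

Let tau_lt i : tau i < tau i.+1. Proof. by rewrite tauS ltrDl. Qed.

Let tau_le i j : (i <= j)%N -> tau i <= tau j.
Proof. by move=> ij; rewrite lerD2l ler_pM2r// ler_nat. Qed.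

Let tau0 : tau 0%N = t. Proof. by rewrite /tau mul0r addr0. Qed.

Let tau_end : tau n.+1 = t + delta.
Proof. by rewrite /tau mulrC divfK ?pnatr_eq0. Qed.

Let tau_ge0 i : 0 <= tau i.
Proof. by rewrite (le_trans t_ge0)// -[leLHS]tau0 tau_le. Qed.

Let tau_leT i : (i <= n.+1)%N -> tau i <= T.
Proof. by move=> /tau_le /le_trans; apply; rewrite tau_end. Qed.

Let tau_in i : (i <= n.+1)%N -> 0 <= tau i <= T.
Proof. by move=> ?; rewrite tau_ge0 tau_leT. Qed.

Let X_Lfun2 i : (i <= n)%N -> X i \in Lfun P 2%:E.
Proof. by move=> ?; apply: (increment_Lfun2 filtr (bm r)); rewrite ?tau_leT// ltW. Qed.

Let Y_Lfun2 i : (i <= n)%N -> Y i \in Lfun P 2%:E.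
Proof. by move=> ?; apply: (increment_Lfun2 filtr (bm s)); rewrite ?tau_leT// ltW. Qed.

Let indep (U V : Omega -> R) :
  measurable_wrt (sigma_algebra_of_process T (W r)) U ->
  measurable_wrt (sigma_algebra_of_process T (W s)) V -> independent_rv P U V.
Proof. exact: processes_independent. Qed.

Let X_process i : (i <= n)%N -> measurable_wrt (sigma_algebra_of_process T (W r)) (X i).
Proof.
by move=> ?; apply: increment_measurable_process; apply: tau_in => //; exact: ltnW.
Qed.

Let Y_process i : (i <= n)%N -> measurable_wrt (sigma_algebra_of_process T (W s)) (Y i).
Proof.
by move=> ?; apply: increment_measurable_process; apply: tau_in => //; exact: ltnW.
Qed.

Let Z_Lfun2 i : (i <= n)%N -> Z i \in Lfun P 2%:E.
Proof.
move=> in_; apply: independent_Lfun2M (X_Lfun2 in_) (Y_Lfun2 in_).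
by apply: indep; [exact: X_process|exact: Y_process].
Qed.

Let S_Lfun2 k : (k <= n.+1)%N -> S k \in Lfun P 2%:E.
Proof.
elim: k => [|k IH] kn.
  by rewrite /S; under eq_fun do rewrite big_ord0; exact: (Lfun_cst P 0).
by rewrite /S; under eq_fun do rewrite big_ord_recr/=; apply: Lfun2D;
  [exact: IH (ltnW kn)|exact: Z_Lfun2].
Qed.

(** The two motions being independent, the expectation factors through them. *)
Let integral_ZZ i j : (i <= n)%N -> (j <= n)%N ->
  \int[P]_w (Z i w * Z j w) =
  \int[P]_w (X i w * X j w) * \int[P]_w (Y i w * Y j w).
Proof.
move=> in_ jn.
have [_ <-] := @independent_integral _ _ _ P (fun w => X i w * X j w) (fun w => Y i w * Y j w)
  (indep (measurable_funM (X_process in_) (X_process jn))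
         (measurable_funM (Y_process in_) (Y_process jn)))
  (measurable_funM (Lfun2_measurable (X_Lfun2 in_)) (Lfun2_measurable (X_Lfun2 jn)))
  (measurable_funM (Lfun2_measurable (Y_Lfun2 in_)) (Lfun2_measurable (Y_Lfun2 jn)))
  (Lfun2_integrableM (X_Lfun2 in_) (X_Lfun2 jn))
  (Lfun2_integrableM (Y_Lfun2 in_) (Y_Lfun2 jn)).
by apply: eq_Rintegral => w _; rewrite /Z mulrACA.
Qed.

Let integral_ZZ0 i j : (i < j)%N -> (j <= n)%N -> \int[P]_w (Z i w * Z j w) = 0.
Proof.
move=> ij jn; have in_ := ltnW (leq_trans ij jn).
rewrite integral_ZZ// (integral_past_increment filtr (bm r)) ?mul0r//.
- exact: tau_leT.
- apply: (measurable_wrt_filtration filtr (a := tau i.+1)) => //.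
  + exact: tau_le.
  + exact: tau_leT (leqW jn).
  + by apply: (increment_adapted filtr (bm r)); rewrite ?tau_leT// ltW.
- exact: X_Lfun2.
Qed.

Let integral_Z2 i : (i <= n)%N -> \int[P]_w (Z i w * Z i w) <= step ^+ 2.
Proof.
move=> in_; rewrite integral_ZZ//.
have mom u : \int[P]_w (increment (W u) (tau i) (tau i.+1) w *
                        increment (W u) (tau i) (tau i.+1) w) <= step.
  rewrite (_ : step = tau i.+1 - tau i); last by rewrite tauS addrAC subrr add0r.
  apply: le_trans (increment_sqr_moment filtr (bm u) _ (tau_lt i) (@tau_leT i.+1 in_)) => //.
by rewrite expr2 ler_pM ?mom//; apply: Rintegral_ge0 => w _; rewrite -expr2 sqr_ge0.
Qed.

Let integral_SZ0 j k : (j <= k)%N -> (k <= n)%N -> \int[P]_w (S j w * Z k w) = 0.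
Proof.
elim: j => [|j IH] jk kn.
  under eq_Rintegral do rewrite /S big_ord0 mul0r.
  by rewrite Rintegral_cst// mul0r.
under eq_Rintegral do rewrite /S big_ord_recr/= mulrDl.
rewrite RintegralD//.
- by rewrite IH ?(ltnW jk)// integral_ZZ0// addr0.
- apply: Lfun2_integrableM (Z_Lfun2 kn).
  exact: S_Lfun2 (leq_trans (ltnW jk) (leqW kn)).
- exact: Lfun2_integrableM (Z_Lfun2 (leq_trans (ltnW jk) kn)) (Z_Lfun2 kn).
Qed.

(** The [Z i] are orthogonal and of squared norm at most [step^2]. Hence the squared
    norm of the full sum is at most [delta^2 / n.+1], the vanishing quadratic
    covariation of independent motions. *)
Let integral_S2 k : (k <= n.+1)%N -> \int[P]_w (S k w * S k w) <= k%:R * step ^+ 2.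
Proof.
elim: k => [|k IH] kn.
  under eq_Rintegral do rewrite /S big_ord0 mul0r.
  by rewrite Rintegral_cst// !mul0r.
have lS := S_Lfun2 (ltnW kn); have lZ := Z_Lfun2 kn.
have iSZ := Lfun2_integrableM lS lZ.
under eq_Rintegral => w _.
  rewrite /S big_ord_recr/= -/(S k w).
  rewrite (_ : _ * _ = S k w * S k w + 2 * (S k w * Z k w) + Z k w * Z k w); last by ring.
  over.
have i1 := Lfun2_integrableM lS lS.
have i2 : P.-integrable setT (EFin \o (fun w => 2 * (S k w * Z k w))).
  by have := integrableZl measurableT 2 iSZ.
rewrite RintegralD//; last 2 first.
- exact: (integrableD measurableT i1 i2).
- exact: Lfun2_integrableM.
rewrite RintegralD// RintegralZl// integral_SZ0// mulr0 addr0.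
by rewrite -natr1 mulrDl mul1r lerD ?IH ?integral_Z2// ltnW.
Qed.

(** Only the products over the same subinterval survive: in a mixed product the
    later increment is centered and independent of everything before it. *)
Let integral_cWW k : (k <= n.+1)%N ->
  \int[P]_w (c w * (increment (W r) t (tau k) w * increment (W s) t (tau k) w)) =
  \int[P]_w (c w * S k w).
Proof.
elim: k => [|k IH] kn.
  by apply: eq_Rintegral => w _; rewrite tau0 /increment subrr mul0r /S big_ord0.
pose A := increment (W r) t (tau k); pose B := increment (W s) t (tau k).
have t_tau : t <= tau k by rewrite -[leLHS]tau0 tau_le.
have tauT : tau k <= T by rewrite tau_leT// ltnW.
have mcF : measurable_wrt (F (tau k)) c
  by exact: (measurable_wrt_filtration filtr t_ge0 t_tau tauT mc).
have mcA : measurable_wrt (F (tau k)) (fun w => c w * A w).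
  by apply: measurable_funM => //; exact: (increment_adapted filtr (bm r)).
have mcB : measurable_wrt (F (tau k)) (fun w => c w * B w).
  by apply: measurable_funM => //; exact: (increment_adapted filtr (bm s)).
have lA : A \in Lfun P 2%:E by exact: (increment_Lfun2 filtr (bm r)).
have lB : B \in Lfun P 2%:E by exact: (increment_Lfun2 filtr (bm s)).
have lcA : (fun w => c w * A w) \in Lfun P 2%:E by exact: bounded_Lfun2M cK lA.
have lcB : (fun w => c w * B w) \in Lfun P 2%:E by exact: bounded_Lfun2M cK lB.
have lAB : (fun w => A w * B w) \in Lfun P 2%:E.
  apply: independent_Lfun2M lA lB.
  by apply: indep; apply: increment_measurable_process; rewrite ?tau_in ?t_in// ltnW.
have iAB := Lfun2_integrable (bounded_Lfun2M mc' cK lAB).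
have icAY := Lfun2_integrableM lcA (Y_Lfun2 kn).
have icBX := Lfun2_integrableM lcB (X_Lfun2 kn).
have icZ := Lfun2_integrable (bounded_Lfun2M mc' cK (Z_Lfun2 kn)).
have icS := Lfun2_integrable (bounded_Lfun2M mc' cK (S_Lfun2 (ltnW kn))).
under eq_Rintegral => w _.
  rewrite (_ : c w * _ = (c w * (A w * B w) + c w * A w * Y k w) +
    (c w * B w * X k w + c w * Z k w)); last first.
    by rewrite /A /B /Z /X /Y /increment; ring.
  over.
rewrite RintegralD//; last 2 first.
- exact: (integrableD measurableT iAB icAY).
- exact: (integrableD measurableT icBX icZ).
rewrite !RintegralD// IH ?(ltnW kn)//.
rewrite (integral_past_increment filtr (bm s))//; last exact: tau_leT.
rewrite (integral_past_increment filtr (bm r))//; last exact: tau_leT.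
rewrite addr0 add0r -RintegralD//.
by apply: eq_Rintegral => w _; rewrite /S big_ord_recr/= mulrDr.
Qed.

(** Young's inequality [2 * (a * c) * S <= e * (a * c)^2 + e^-1 * S^2] for the sum [S]
    of the products over all subintervals. The factor [a] stands for a sign. *)
Lemma cross_moment_le (a e : R) : `|a| <= 1 -> 0 < e ->
  2 * (a * \int[P]_w (c w * (increment (W r) t (t + delta) w *
                             increment (W s) t (t + delta) w)))
    <= e * K ^+ 2 + delta ^+ 2 / n.+1%:R / e.
Proof.
move=> a1 e0; rewrite -tau_end integral_cWW//.
have lS := S_Lfun2 (leqnn n.+1).
have lc : c \in Lfun P 2%:E by exact: Lfun2_bounded cK.
have icS := Lfun2_integrableM lc lS.
rewrite mulrA -RintegralZl//.
have iS2 := Lfun2_integrableM lS lS.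
have iS2e : P.-integrable setT (EFin \o (fun w => e^-1 * (S n.+1 w * S n.+1 w))).
  by have := integrableZl measurableT e^-1 iS2.
have iK : P.-integrable setT (EFin \o cst (e * K ^+ 2)).
  exact: finite_measure_integrable_cst.
apply: (@le_trans _ _ (\int[P]_w (e * K ^+ 2 + e^-1 * (S n.+1 w * S n.+1 w)))).
  apply: le_Rintegral => //.
  - by have := integrableZl measurableT (2 * a) icS.
  - exact: (integrableD measurableT iK iS2e).
  move=> w _; set u := S _ _.
  have ac : (a * c w) ^+ 2 <= K ^+ 2.
    have K0 : 0 <= K := le_trans (normr_ge0 _) (cK w).
    rewrite -[leLHS]real_normK ?num_real// ler_sqr ?nnegrE// normrM.
    by rewrite (le_trans _ (cK w))// ler_piMl.
  have sq := sqr_ge0 (e * (a * c w) - u).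
  rewrite -(ler_pM2l e0) mulrDr [e * (e^-1 * _)]mulrA divff ?gt_eqF// mul1r.
  have := ler_wpM2l (ltW e0) (ler_wpM2l (ltW e0) ac).
  move: (c w) sq => x; lra.
rewrite RintegralD// Rintegral_cst//= probability_setT mulr1 lerD2l RintegralZl//.
rewrite mulrC ler_wpM2r ?invr_ge0 ?(ltW e0)//.
apply: le_trans (integral_S2 (leqnn _)) _; rewrite /step le_eqVlt; apply/orP; left.
by apply/eqP; field; rewrite ?nat1r ?natr1 pnatr_eq0.
Qed.

End subdivision.

(** Conditionally on the past, increments of distinct motions are uncorrelated.
    Each increment is independent of the past, and the two motions are
    independent of each other; these facts at the two ends of the step alone would
    still allow the pair of increments to be correlated given the past. What
    excludes it is that they hold on every subinterval: the error term of the
    previous bound tends to [0] as the subdivision is refined. *)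
Lemma integral_cross_increments :
  \int[P]_w (c w * (increment (W r) t (t + delta) w *
                    increment (W s) t (t + delta) w)) = 0.
Proof.
set v := Rintegral _ _ _.
have bound a e : `|a| <= 1 -> 0 < e -> 2 * (a * v) <= e * (K ^+ 2 + 1).
  (* This many subintervals make the last term of the bound at most e. *)
  move=> a1 e0; pose n := Num.bound (delta ^+ 2 / e ^+ 2).
  apply: le_trans (cross_moment_le n a1 e0) _.
  rewrite mulrDr mulr1 lerD2l ler_pdivrMr// -expr2 ler_pdivrMr//.
  rewrite mulrC -ler_pdivrMr ?exprn_gt0//.
  apply: (@le_trans _ _ n%:R); last by rewrite ler_nat.
  by apply/ltW/archi_boundP; rewrite divr_ge0 ?sqr_ge0.
have K0 : 0 < K ^+ 2 + 1 by rewrite ltr_wpDl ?sqr_ge0.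
apply/eqP; rewrite -normr_le0; apply/ler_addgt0Pr => e e0; rewrite add0r.
have : 2 * (Num.sg v * v) <= (e / (K ^+ 2 + 1)) * (K ^+ 2 + 1).
  by apply: bound; rewrite ?divr_gt0// normr_sg; case: (v != 0).
rewrite divfK ?gt_eqF// -normrEsg.
by apply: le_trans; rewrite mulr_natl mulr2n lerDl.
Qed.

End cross_moment.
End brownian_family.

(** * Sums of increments with coefficients from the past *)

Section stochastic_sum.
Context {disp : measure_display} {Omega : measurableType disp} {R : realType}.
Variables (P : probability Omega R) (T : R) (F : R -> set (set Omega)).
Variables (m : nat) (W : 'I_m -> R -> Omega -> R).
Hypotheses (filtr : filtration T F) (BM : independent_brownian_motions P T F W).
Variables (t delta : R) (c : 'I_m -> Omega -> R).
Hypotheses (t_ge0 : 0 <= t) (delta_gt0 : 0 < delta) (tT : t + delta <= T).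
Hypotheses (mc : forall r, measurable_wrt (F t) (c r)).
Hypothesis (c_bounded : forall r, exists K, forall w, `|c r w| <= K).

Let xi r := increment (W r) t (t + delta).
Let N w := \sum_(r < m) xi r w * c r w.

Let bm r : standard_brownian_motion P T F (W r). Proof. by case: BM. Qed.

Let t_lt : t < t + delta. Proof. by rewrite ltrDl. Qed.

Let t_in : 0 <= t <= T. Proof. by rewrite t_ge0 (le_trans _ tT)// ltW. Qed.

Let Ft := filtration_sub_sigma_algebra filtr t_in.

Let mc' r : measurable_fun [set: Omega] (c r).
Proof. exact: measurable_wrt_measurable Ft (mc r). Qed.

Let xi_Lfun2 r : xi r \in Lfun P 2%:E.
Proof. exact: (increment_Lfun2 filtr (bm r) t_ge0 (ltW t_lt) tT). Qed.

Let c_Lfun2 r : c r \in Lfun P 2%:E.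
Proof. by have [K cK] := c_bounded r; exact: Lfun2_bounded cK. Qed.

Let xic_Lfun2 r : (fun w => xi r w * c r w) \in Lfun P 2%:E.
Proof.
under eq_fun do rewrite mulrC.
by have [K cK] := c_bounded r; exact: bounded_Lfun2M cK (xi_Lfun2 r).
Qed.

Lemma stochastic_sum_Lfun2 : N \in Lfun P 2%:E.
Proof. exact: Lfun2_sum. Qed.

Lemma stochastic_sum_adapted : measurable_wrt (F (t + delta)) N.
Proof.
apply: measurable_sum => r; apply: measurable_funM.
  exact: (increment_adapted filtr (bm r) t_ge0 (ltW t_lt) tT).
exact: (measurable_wrt_filtration filtr t_ge0 (ltW t_lt) tT (mc r)).
Qed.

(** The indicator of a past event is absorbed into the bounded coefficients. *)
Lemma integral_past_stochastic_sum A : F t A -> (\int[P]_(w in A) (N w)%:E = 0)%E.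
Proof.
move=> FA; have [sF Fm] := Ft.
have mA := Fm _ FA.
have mI : measurable_wrt (F t) (\1_A : Omega -> R).
  apply: measurable_indic.
  by rewrite -[measurable]/(<<s F t >>) sigma_algebra_id.
have I1 w : `|\1_A w : R| <= 1 by rewrite indicE; case: (_ \in _); rewrite ?normr1 ?normr0.
rewrite integral_mkcond.
transitivity (\int[P]_w (\sum_(r < m) (\1_A w * c r w) * xi r w)%:E)%E.
  apply: eq_integral => w _; rewrite patchE indicE; case: (w \in A).
    by congr EFin; apply: eq_bigr => r _; rewrite mul1r mulrC.
  by rewrite big1// => r _; rewrite !mul0r.
rewrite -[LHS]fineK; last first.
  apply: integrable_fin_num => //; apply: integrable_Rsum => r.
  apply: Lfun2_integrableM => //; have [K cK] := c_bounded r.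
  apply: bounded_Lfun2M I1 (c_Lfun2 r).
  exact: measurable_indic.
congr EFin; rewrite -/(Rintegral _ _ _) Rintegral_sum.
  rewrite big1// => r _.
  rewrite (integral_past_increment filtr (bm r) t_ge0 t_lt tT)//.
    exact: (measurable_funM mI (mc r)).
  apply: bounded_Lfun2M I1 (c_Lfun2 r); exact: measurable_indic.
move=> r; apply: Lfun2_integrableM => //.
apply: bounded_Lfun2M I1 (c_Lfun2 r); exact: measurable_indic.
Qed.

(** The one-step Ito isometry, as an inequality: the mixed terms vanish and the
    squared increments are independent of the squared coefficients. *)
Lemma stochastic_sum_sqr_moment :
  \int[P]_w (N w ^+ 2) <= delta * \sum_(r < m) \int[P]_w (c r w ^+ 2).
Proof.
under eq_Rintegral => w _.
  rewrite expr2 {1}/N mulr_suml; under eq_bigr do rewrite mulr_sumr.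
  over.
rewrite Rintegral_sum; last first.
  by move=> r; apply: integrable_Rsum => s; exact: Lfun2_integrableM.
rewrite mulr_sumr; apply: ler_sum => r _.
rewrite Rintegral_sum; last by move=> s; exact: Lfun2_integrableM.
rewrite (bigD1 r)//= big1 ?addr0; last first.
  move=> s sr; have [K cK] := c_bounded r; have [K' cK'] := c_bounded s.
  rewrite -[RHS](@integral_cross_increments _ _ _ P T F m W filtr BM r s t delta
    (fun w => c r w * c s w) (K * K') _ t_ge0 delta_gt0 tT) 1?eq_sym//.
  - by apply: eq_Rintegral => w _; rewrite mulrACA mulrC.
  - exact: (measurable_funM (mc r) (mc s)).
  - by move=> w; rewrite normrM ler_pM.
have [K cK] := c_bounded r.
have indep : independent_rv P (fun w => c r w ^+ 2) (fun w => xi r w ^+ 2).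
  have := increment_independent filtr (bm r) t_ge0 t_lt tT (mc r).
  apply: (@independent_rv_comp _ _ _ P _ _ (fun x => x ^+ 2) (fun x => x ^+ 2));
    exact: exprn_measurable.
have [mxi ixi] := (Lfun2P _ _).1 (xi_Lfun2 r).
have [_ ic] := (Lfun2P _ _).1 (c_Lfun2 r).
have [_ e] := independent_integral indep (measurable_funX 2 (mc' r)) (measurable_funX 2 mxi) ic ixi.
under eq_Rintegral => w _.
  rewrite (_ : _ * _ = c r w ^+ 2 * xi r w ^+ 2); last by rewrite mulrACA mulrC !expr2.
  over.
rewrite e mulrC ler_wpM2r//; first by apply: Rintegral_ge0 => w _; exact: sqr_ge0.
apply: le_trans (increment_sqr_moment filtr (bm r) t_ge0 t_lt tT) _.
by rewrite addrAC subrr add0r.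
Qed.

End stochastic_sum.

(** * Uniqueness of conditional expectations *)

Section conditional_expectation.
Context {disp : measure_display} {Omega : measurableType disp} {R : realType}.
Variables (P : probability Omega R) (G : set (set Omega)).
Hypothesis subG : sub_sigma_algebra_of_measurable G.

(** Two versions are compared as functions on [Omega] equipped with the
    sub-sigma-algebra alone, where equality of the integrals over all events
    forces equality almost everywhere. *)
Lemma is_cond_exp_ae_unique (X Y Y' : Omega -> R) :
  is_cond_exp P G X Y -> is_cond_exp P G X Y' ->
  {ae P, forall w, Y w = Y' w}.
Proof.
move=> [mY iY YX] [mY' iY' YX'].
have [sG Gm] := subG.
have GE (A : set (g_sigma_algebraType G)) : measurable A = G A.
  by exact: (congr1 (@^~ A) (sigma_algebra_id sG)).
have mid : measurable_fun [set: Omega] (idfun : Omega -> g_sigma_algebraType G).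
  by move=> _ A mA; rewrite setTI preimage_id; apply: Gm; rewrite -GE.
pose phi : {mfun Omega >-> g_sigma_algebraType G} :=
  HB.pack (idfun : Omega -> g_sigma_algebraType G)
    (isMeasurableFun.Build _ _ _ _ _ mid).
pose mu : probability (g_sigma_algebraType G) R := distribution P phi.
have push (V : Omega -> R) : measurable_wrt G V -> P.-integrable setT (EFin \o V) ->
  forall A, G A -> (\int[mu]_(w in A) (V w)%:E = \int[P]_(w in A) (V w)%:E)%E.
  move=> mV iV A GA.
  rewrite [LHS](@integral_pushforward _ _ _ _ _ phi)//.
  - exact/measurable_EFinP.
  - by apply: integrableS iV => //; exact: Gm.
  - by rewrite GE.
have iYmu : mu.-integrable setT (EFin \o Y).
  by apply: integrable_pushforward => //; exact/measurable_EFinP.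
have : ae_eq mu setT (EFin \o Y) (EFin \o Y').
  apply: integral_ae_eq => //; first exact/measurable_EFinP.
  move=> A _; rewrite GE => GA.
  by rewrite !push// YX// YX'.
move=> [A [mA muA sub]]; exists A; split => //.
  by apply: Gm; rewrite -GE.
by move=> w /= Yw; apply: sub => /= /(_ I) [].
Qed.

Lemma cond_exp_ae (X Y : Omega -> R) : is_cond_exp P G X Y ->
  {ae P, forall w, cond_exp P G X w = Y w}.
Proof.
move=> XY; apply: (is_cond_exp_ae_unique (X := X)) => //.
exact: (xgetI (cst 0) XY).
Qed.

End conditional_expectation.

(** * Measurability of random vectors *)

Section random_vectors.
Context {disp : measure_display} {Omega : measurableType disp} {R : realType} {d : nat}.
Variable G : set (set Omega).
Implicit Types (Y : Omega -> 'rV[R]_d).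

Lemma continuous_measurable_wrt Y (phi : 'rV[R]_d -> R) :
  vmeasurable_wrt G Y -> continuous phi -> measurable_wrt G (phi \o Y).
Proof.
move=> mY cphi; apply: (measurability _ (RGenOInfty.measurableE R)) => //.
move=> _ [_ [a ->] <-]; rewrite setTI comp_preimage -[X in measurable X]setTI.
apply: mY => //; apply: sub_sigma_algebra.
by apply: open_comp; [move=> x _; exact: cphi|exact: interval_open].
Qed.

(** The topology of ['rV[R]_d] is that of the maximum norm, hence the passage
    through a bound on the coordinates. *)
Lemma lipschitz_continuous (phi : 'rV[R]_d -> R) (K : R) :
  (forall x y, `|phi x - phi y| <= K * enorm (x - y)) -> continuous phi.
Proof.
move=> lip x A /nbhs_ballP[e /= e0 eA].
pose M := (`|K| + 1) * (d%:R + 1).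
have M0 : 0 < M by rewrite mulr_gt0// ltr_wpDl.
apply/nbhs_ballP; exists (e / M / 2) => /=; first by rewrite !divr_gt0.
move=> y xy; apply: eA; rewrite /ball/=.
have b0 : 0 <= e / M / 2 by rewrite !divr_ge0// ltW.
have := @enorm_le_coords R d (x - y) _ b0.
have xyb i : `|(x - y) 0 i| <= e / M / 2.
  by have [_ /(_ 0 i)] := xy; rewrite /ball/= !mxE => /ltW.
move=> /(_ xyb) enorm_xy.
have K1 : K <= `|K| + 1 by rewrite (le_trans (ler_norm K))// lerDl.
apply: le_lt_trans (lip _ _) _.
apply: (@le_lt_trans _ _ (M * (e / M / 2))).
  rewrite /M -mulrA.
  apply: (@le_trans _ _ ((`|K| + 1) * enorm (x - y))).
    by rewrite ler_wpM2r// enorm_ge0.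
  by rewrite ler_wpM2l.
clearbody M; have -> : M * (e / M / 2) = e / 2 by field; rewrite gt_eqF.
by rewrite ltr_pdivrMr// ltr_pMr// ltr1n.
Qed.

(** Every open set is the union of the boxes with rational centre and radius that
    it contains, of which there are countably many, and the preimage of a box is
    a finite intersection of preimages under the coordinates. *)
Lemma coordinates_vmeasurable Y :
  (forall i, measurable_wrt G (fun w => Y w 0 i)) -> vmeasurable_wrt G Y.
Proof.
move=> mY.
apply: (measurability (rT := g_sigma_algebraType (@open 'rV[R]_d)) (@open 'rV[R]_d)) => //.
move=> _ [V oV <-]; rewrite setTI.
pose box (p : 'rV[rat]_d * nat) : set 'rV[R]_d :=
  [set x | forall i, `|ratr (p.1 0 i) - x 0 i| < p.2.+1%:R^-1].
have -> : Y @^-1` V = \bigcup_p [set w | box p `<=` V /\ box p (Y w)].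
  apply/seteqP; split => [w /= Vw|w [p _ [pV Yw]]]; last exact: pV.
  have /nbhs_ballP[e /= e0 eV] : nbhs (Y w) V by exact: open_nbhs_nbhs.
  pose k := Num.bound (2 / e).
  have ke : k.+1%:R^-1 < e / 2.
    rewrite -[ltRHS]invf_div ltf_pV2 ?posrE ?divr_gt0 ?ltr0n//.
    apply: (@lt_trans _ _ k%:R); last by rewrite ltr_nat.
    by apply: archi_boundP; rewrite divr_ge0// ltW.
  have k0 : (0 : R) < k.+1%:R^-1 by rewrite invr_gt0 ltr0n.
  have approx i : exists q : rat, `|ratr q - Y w 0 i| < k.+1%:R^-1.
    have /rat_in_itvoo[q] : Y w 0 i - k.+1%:R^-1 < Y w 0 i + k.+1%:R^-1.
      by rewrite ltrD2l gtrN.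
    by rewrite in_itv/= => qi; exists q; rewrite ltr_distl.
  pose a : 'rV[rat]_d := \row_i projT1 (cid (approx i)).
  exists (a, k) => //=; split.
    move=> x ax; apply: eV; split => // i j; rewrite (ord1 i) /ball/=.
    have := ax j; rewrite /= mxE; case: cid => q /= hq hx.
    rewrite (_ : Y w 0 j - x 0 j = (ratr q - x 0 j) - (ratr q - Y w 0 j)); last by ring.
    apply: le_lt_trans (ler_normB _ _) _.
    by rewrite (splitr e) ltrD// (lt_trans _ ke).
  by move=> i; rewrite /= mxE; case: cid.
apply: countable_bigcupT_measurable => [|p]; first exact: countableP.
have [pV|pV] := pselect (box p `<=` V); last first.
  rewrite (_ : mkset _ = set0); first exact: measurable0.
  by apply/seteqP; split => w // [].
rewrite (_ : mkset _ = \bigcap_(i in [set: 'I_d])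
    ((fun w => Y w 0 i) @^-1` [set u | `|ratr (p.1 0 i) - u| < p.2.+1%:R^-1])); last first.
  by apply/seteqP; split => [w [_ pw] i _|w pw]; [exact: pw|split => // i; exact: pw].
apply: fin_bigcap_measurable => // i _.
rewrite -[X in measurable X]setTI; apply: mY => //.
rewrite (_ : mkset _ = `](ratr (p.1 0 i) - p.2.+1%:R^-1), (ratr (p.1 0 i) + p.2.+1%:R^-1)[%classic).
  exact: measurable_itv.
by apply/seteqP; split => u /=; rewrite in_itv/= distrC ltr_distl.
Qed.

End random_vectors.

(** * Stability of explicit steps *)

Section L2norm_theory.
Context {disp : measure_display} {Omega : measurableType disp} {R : realType} {d : nat}.
Variable P : probability Omega R.
Implicit Types V : Omega -> 'rV[R]_d.

Lemma L2norm_sqr V : (L2norm P V ^+ 2 = \int[P]_w (enorm (V w) ^+ 2)%:E)%E.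
Proof.
have sqrE (x : \bar R) : (0 <= x -> x ^+ 2 = x `^ 2)%E.
  case: x => [x| |]//; first by rewrite lee_fin => x0; rewrite poweR_EFin powR_mulrn.
  by move=> _; rewrite poweRyr// /expe/= mulyy.
rewrite sqrE ?Lnorm_ge0// /L2norm poweR_Lnorm//; apply: eq_integral => w _ /=.
by rewrite ger0_norm ?enorm_ge0// powR_mulrn ?enorm_ge0.
Qed.

Lemma measurable_sqr_enorm V : (forall i, measurable_fun [set: Omega] (fun w => V w 0 i)) ->
  measurable_fun [set: Omega] (fun w => enorm (V w) ^+ 2).
Proof.
move=> mV; under eq_fun do rewrite sqr_enormE.
by apply: measurable_sum => i; exact: measurable_funX.
Qed.

Lemma L2norm_lty V : (forall i, (fun w => V w 0 i) \in Lfun P 2%:E) ->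
  (L2norm P V < +oo)%E.
Proof.
move=> lV; rewrite /L2norm unlock poweR_lty//.
have : P.-integrable setT (EFin \o (fun w => \sum_(i < d) V w 0 i ^+ 2)).
  by apply: integrable_Rsum => i; have [] := (Lfun2P P _).1 (lV i).
move=> /integrableP[_]; apply: le_lt_trans; rewrite le_eqVlt; apply/orP; left; apply/eqP.
apply: eq_integral => w _ /=.
rewrite -sqr_enormE powR_mulrn ?normr_ge0//.
by rewrite !ger0_norm ?sqr_ge0 ?enorm_ge0.
Qed.

Lemma ae_eq_L2norm V V' :
  (forall i, measurable_fun [set: Omega] (fun w => V w 0 i)) ->
  (forall i, measurable_fun [set: Omega] (fun w => V' w 0 i)) ->
  {ae P, forall w, V w = V' w} -> (L2norm P V ^+ 2 = L2norm P V' ^+ 2)%E.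
Proof.
move=> mV mV' VV'; rewrite !L2norm_sqr; apply: ae_eq_integral => //.
- exact/measurable_EFinP/measurable_sqr_enorm.
- exact/measurable_EFinP/measurable_sqr_enorm.
- by apply: filterS VV' => w /= -> _.
Qed.

Lemma integrable_EFin_Rintegral (X : Omega -> R) : P.-integrable setT (EFin \o X) ->
  (\int[P]_w (X w)%:E = (\int[P]_w X w)%:E)%E.
Proof. by move=> iX; rewrite /Rintegral fineK//; exact: integrable_fin_num. Qed.

End L2norm_theory.

(** An explicit step with general coefficients [a] and [b]: the stochastic part of the
    argument only depends on their boundedness and Lipschitz continuity. *)
Definition explicit_step {disp : measure_display} {Omega : measurableType disp}
    {R : realType} {d m : nat} (W : 'I_m -> R -> Omega -> R) (t delta : R)
    (a : 'rV[R]_d -> 'rV[R]_d) (b : 'I_m -> 'rV[R]_d -> 'rV[R]_d)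
    (Y : Omega -> 'rV[R]_d) (w : Omega) : 'rV[R]_d :=
  a (Y w) + \sum_(r < m) increment (W r) t (t + delta) w *: b r (Y w).

Section explicit_step.
Context {disp : measure_display} {Omega : measurableType disp} {R : realType}.
Variables (P : probability Omega R) (T : R) (F : R -> set (set Omega)).
Variables (d m : nat) (W : 'I_m -> R -> Omega -> R).
Hypotheses (filtr : filtration T F) (BM : independent_brownian_motions P T F W).
Variables (t delta : R).
Hypotheses (t_ge0 : 0 <= t) (delta_gt0 : 0 < delta) (tT : t + delta <= T).
Variables (a : 'rV[R]_d -> 'rV[R]_d) (b : 'I_m -> 'rV[R]_d -> 'rV[R]_d).
Hypotheses
  (a_lip : exists K, forall x y, enorm (a x - a y) <= K * enorm (x - y))
  (b_lip : forall r, exists K, forall x y, enorm (b r x - b r y) <= K * enorm (x - y))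
  (a_bounded : exists K, forall x, enorm (a x) <= K)
  (b_bounded : forall r, exists K, forall x, enorm (b r x) <= K).
Implicit Types Y Z : Omega -> 'rV[R]_d.

Let xi r := increment (W r) t (t + delta).
Local Notation step := (explicit_step W t delta a b).

Let t_lt : t < t + delta. Proof. by rewrite ltrDl. Qed.
Let t_in : 0 <= t <= T. Proof. by rewrite t_ge0 (le_trans _ tT)// ltW. Qed.
Let Ft := filtration_sub_sigma_algebra filtr t_in.

Let lipschitz_coordinate_measurable (u : 'rV[R]_d -> 'rV[R]_d) Y i :
  (exists K, forall x y, enorm (u x - u y) <= K * enorm (x - y)) ->
  vmeasurable_wrt (F t) Y -> measurable_wrt (F t) (fun w => u (Y w) 0 i).
Proof.
move=> [K lip] mY.
apply: (@continuous_measurable_wrt _ _ _ _ _ Y (fun x => u x 0 i)) => //.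
apply: (@lipschitz_continuous _ _ _ K) => x y; apply: le_trans (lip x y).
by have := coord_le_enorm (u x - u y) i; rewrite !mxE.
Qed.

Let bounded_coordinate (u : 'rV[R]_d -> 'rV[R]_d) Y i :
  (exists K, forall x, enorm (u x) <= K) ->
  exists K, forall w, `|u (Y w) 0 i| <= K.
Proof. by move=> [K uK]; exists K => w; exact: le_trans (coord_le_enorm _ _) (uK _). Qed.

Let stepE Y w i : step Y w 0 i = a (Y w) 0 i + \sum_(r < m) xi r w * b r (Y w) 0 i.
Proof. by rewrite /explicit_step mxE summxE; congr (_ + _); apply: eq_bigr => r _; rewrite mxE. Qed.

Lemma explicit_step_L2 Y : vmeasurable_wrt (F t) Y -> L2 P (F (t + delta)) (step Y).
Proof.
move=> mY.
have ma i := lipschitz_coordinate_measurable i a_lip mY.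
have mb r i := lipschitz_coordinate_measurable i (b_lip r) mY.
have bb r i := bounded_coordinate Y i (b_bounded r).
split.
  apply: coordinates_vmeasurable => i; under eq_fun do rewrite stepE.
  apply: measurable_funD.
    exact: (measurable_wrt_filtration filtr t_ge0 (ltW t_lt) tT (ma i)).
  exact: (stochastic_sum_adapted filtr BM).
apply: L2norm_lty => i; under eq_fun do rewrite stepE; apply: Lfun2D.
  have [K aK] := bounded_coordinate Y i a_bounded.
  by apply: Lfun2_bounded aK; exact: measurable_wrt_measurable Ft (ma i).
exact: (stochastic_sum_Lfun2 filtr BM).
Qed.

Section difference.
Variables Y Z : Omega -> 'rV[R]_d.
Hypotheses (mY : vmeasurable_wrt (F t) Y) (mZ : vmeasurable_wrt (F t) Z).
Let D w := step Y w - step Z w.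
Let A w := a (Y w) - a (Z w).
Let B r w := b r (Y w) - b r (Z w).
Let N w : 'rV[R]_d := \sum_(r < m) xi r w *: B r w.

Let NE i w : N w 0 i = \sum_(r < m) xi r w * B r w 0 i.
Proof. by rewrite summxE; apply: eq_bigr => r _; rewrite mxE. Qed.

Let DE w : D w = A w + N w.
Proof.
rewrite /D /explicit_step opprD addrACA; congr (_ + _); rewrite /N -sumrB.
by apply: eq_bigr => r _; rewrite scalerBr.
Qed.

Let mA i : measurable_wrt (F t) (fun w => A w 0 i).
Proof.
by under eq_fun do rewrite !mxE; apply: measurable_funB; exact: lipschitz_coordinate_measurable.
Qed.

Let mB r i : measurable_wrt (F t) (fun w => B r w 0 i).
Proof.
by under eq_fun do rewrite !mxE; apply: measurable_funB; exact: lipschitz_coordinate_measurable.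
Qed.

Let A_bounded i : exists K, forall w, `|A w 0 i| <= K.
Proof.
have [K aY] := bounded_coordinate Y i a_bounded.
have [K' aZ] := bounded_coordinate Z i a_bounded.
by exists (K + K') => w; rewrite !mxE (le_trans (ler_normB _ _))// lerD.
Qed.

Let B_bounded r i : exists K, forall w, `|B r w 0 i| <= K.
Proof.
have [K bY] := bounded_coordinate Y i (b_bounded r).
have [K' bZ] := bounded_coordinate Z i (b_bounded r).
by exists (K + K') => w; rewrite !mxE (le_trans (ler_normB _ _))// lerD.
Qed.

Let A_Lfun2 i : (fun w => A w 0 i) \in Lfun P 2%:E.
Proof.
have [K aK] := A_bounded i.
by apply: Lfun2_bounded aK; exact: measurable_wrt_measurable Ft (mA i).
Qed.

Let B_Lfun2 r i : (fun w => B r w 0 i) \in Lfun P 2%:E.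
Proof.
have [K bK] := B_bounded r i.
by apply: Lfun2_bounded bK; exact: measurable_wrt_measurable Ft (mB r i).
Qed.

Let N_Lfun2 i : (fun w => N w 0 i) \in Lfun P 2%:E.
Proof. by under eq_fun do rewrite NE; exact: (stochastic_sum_Lfun2 filtr BM). Qed.

Let is_cond_exp_A i : is_cond_exp P (F t) (fun w => D w 0 i) (fun w => A w 0 i).
Proof.
split; [exact: mA|exact: Lfun2_integrable|move=> G FG].
have mG : measurable G by have [_] := Ft; apply.
under [RHS]eq_integral do rewrite DE mxE EFinD.
rewrite integralD//; last 2 first.
- by apply: integrableS (Lfun2_integrable (A_Lfun2 i)).
- by apply: integrableS (Lfun2_integrable (N_Lfun2 i)).
under [X in (_ + X)%E]eq_integral do rewrite NE.
by rewrite (integral_past_stochastic_sum filtr BM)// adde0.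
Qed.

Let E := vcond_exp P (F t) D.

Let cond_exp_measurable i : measurable_fun [set: Omega] (fun w => E w 0 i).
Proof.
under eq_fun do rewrite mxE.
have [+ _ _] := xgetI (cst 0) (is_cond_exp_A i).
exact: measurable_wrt_measurable.
Qed.

Let cond_exp_ae_A : {ae P, forall w, E w = A w}.
Proof.
have : \forall w \near almost_everywhere P, forall i, E w 0 i = A w 0 i.
  apply: filter_forall => i; have := cond_exp_ae Ft (is_cond_exp_A i).
  by apply: filterS => w /= <-; rewrite mxE.
by apply: filterS => w /= EA; apply/rowP => i; exact: EA.
Qed.

Let mA' i := measurable_wrt_measurable Ft (mA i).

Let N_sqr_moment : (\int[P]_w (enorm (N w) ^+ 2)%:E <=
  \int[P]_w (delta * \sum_(r < m) enorm (B r w) ^+ 2)%:E)%E.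
Proof.
have iN i : P.-integrable setT (EFin \o (fun w => N w 0 i ^+ 2)).
  by have [] := (Lfun2P P _).1 (N_Lfun2 i).
have iB r i : P.-integrable setT (EFin \o (fun w => B r w 0 i ^+ 2)).
  by have [] := (Lfun2P P _).1 (B_Lfun2 r i).
under eq_integral do rewrite sqr_enormE.
under [leRHS]eq_integral => w _.
  under eq_bigr do rewrite sqr_enormE.
  over.
have iBs : P.-integrable setT (EFin \o (fun w => \sum_(r < m) \sum_(i < d) B r w 0 i ^+ 2)).
  by apply: integrable_Rsum => r; exact: integrable_Rsum.
rewrite !integrable_EFin_Rintegral; last 2 first.
- by have := integrableZl measurableT delta iBs.
- exact: integrable_Rsum.
rewrite lee_fin RintegralZl// !Rintegral_sum//; last by move=> r; exact: integrable_Rsum.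
under [X in _ <= _ * X]eq_bigr do rewrite Rintegral_sum//.
rewrite exchange_big mulr_sumr; apply: ler_sum => i _.
under eq_Rintegral do rewrite NE.
exact: (stochastic_sum_sqr_moment filtr BM).
Qed.

(** The conditional expectation of the difference [D = A + N] of two steps is its
    drift part [A], and the remainder is the noise part [N], whose second moment is
    bounded by that of the diffusion coefficients; so the pointwise estimate of
    the coefficients integrates to the claim. *)
Lemma explicit_step_stable (eta C : R) : 0 <= eta -> 0 <= C ->
  (forall x y, enorm (a x - a y) ^+ 2
     + eta * (delta * \sum_(r < m) enorm (b r x - b r y) ^+ 2) <= C * enorm (x - y) ^+ 2) ->
  (L2norm P E ^+ 2 + eta%:E * L2norm P (fun w => (D w - E w)%R) ^+ 2
    <= C%:E * L2norm P (fun w => (Y w - Z w)%R) ^+ 2)%E.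
Proof.
move=> eta0 C0 est.
have mD i : measurable_fun [set: Omega] (fun w => D w 0 i).
  under eq_fun do rewrite DE mxE; apply: measurable_funD => //.
  exact: Lfun2_measurable.
rewrite (ae_eq_L2norm cond_exp_measurable mA' cond_exp_ae_A).
rewrite [X in (_ + _ * X)%E](ae_eq_L2norm (V' := N)); last 3 first.
- by move=> i; under eq_fun do rewrite mxE [X in _ + X]mxE; exact: measurable_funB.
- by move=> i; exact: Lfun2_measurable.
- by apply: filterS cond_exp_ae_A => w /= ->; rewrite DE addrAC subrr add0r.
rewrite !L2norm_sqr.
have mYZ : measurable_fun [set: Omega] (fun w => enorm (Y w - Z w) ^+ 2).
  apply: measurable_sqr_enorm => i; apply: (measurable_wrt_measurable Ft).
  under eq_fun do rewrite !mxE.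
  apply: measurable_funB; apply: (@lipschitz_coordinate_measurable id) => //;
    by exists 1 => x y; rewrite mul1r.
have mBs : measurable_fun [set: Omega] (fun w => \sum_(r < m) enorm (B r w) ^+ 2).
  apply: measurable_sum => r; apply: measurable_sqr_enorm => i.
  exact: measurable_wrt_measurable Ft (mB r i).
have mAs : measurable_fun [set: Omega] (fun w => enorm (A w) ^+ 2).
  exact: measurable_sqr_enorm.
have Bs0 w : 0 <= \sum_(r < m) enorm (B r w) ^+ 2.
  by apply: sumr_ge0 => r _; exact: sqr_ge0.
apply: (@le_trans _ _ (\int[P]_w (enorm (A w) ^+ 2)%:E +
  eta%:E * \int[P]_w (delta * \sum_(r < m) enorm (B r w) ^+ 2)%:E)%E).
  by rewrite leeD2l// lee_wpmul2l// lee_fin.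
have mdBs : measurable_fun [set: Omega]
    (fun w => (delta * \sum_(r < m) enorm (B r w) ^+ 2)%:E).
  by apply/measurable_EFinP; exact: measurable_funM.
have meAs : measurable_fun [set: Omega] (fun w => (enorm (A w) ^+ 2)%:E).
  exact/measurable_EFinP.
have meYZ : measurable_fun [set: Omega] (fun w => (enorm (Y w - Z w) ^+ 2)%:E).
  exact/measurable_EFinP.
have dBs0 w : (0 <= (delta * \sum_(r < m) enorm (B r w) ^+ 2)%:E)%E.
  by rewrite lee_fin mulr_ge0// ltW.
have As0 w : (0 <= (enorm (A w) ^+ 2)%:E)%E by rewrite lee_fin sqr_ge0.
have YZ0 w : (0 <= (enorm (Y w - Z w) ^+ 2)%:E)%E by rewrite lee_fin sqr_ge0.
rewrite -!ge0_integralZl_EFin//.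
have meBs : measurable_fun [set: Omega]
    (fun w => eta%:E * (delta * \sum_(r < m) enorm (B r w) ^+ 2)%:E)%E.
  exact: measurable_funeM.
have eBs0 w : (0 <= eta%:E * (delta * \sum_(r < m) enorm (B r w) ^+ 2)%:E)%E.
  by rewrite mule_ge0.
rewrite -ge0_integralD//; apply: ge0_le_integral => //.
- by move=> w _; rewrite adde_ge0.
- exact: emeasurable_funD.
- exact: measurable_funeM.
- by move=> w _; rewrite -!EFinM -EFinD lee_fin; exact: est.
Qed.

End difference.
End explicit_step.

(** * The projected Euler-Maruyama method *)

Theorem theorem6p4 (R : realType) (disp : measure_display)
    (Omega : measurableType disp) (P : probability Omega R)
    (d m : nat) (T : R) (F : R -> set (set Omega))
    (W : 'I_m -> R -> Omega -> R)
    (L eta q h : R)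
    (f : R -> 'rV[R]_d -> 'rV[R]_d) (g : 'I_m -> R -> 'rV[R]_d -> 'rV[R]_d) :
  (0 < d)%N -> (0 < m)%N -> 0 < T ->
  filtration T F -> usual_conditions P T F ->
  independent_brownian_motions P T F W ->
  0 < L -> 2^-1 < eta -> 1 < q ->
  admissible T L eta q f g ->
  0 < h <= 1 -> h <= T ->
  forall xi : Omega -> 'rV[R]_d, L2 P (F 0) xi ->
    stochastically_C_stable P T F (PEM W (1 / (2 * (q - 1))) f g) h xi.
Proof.
move=> _ m0 _ filtr _ BM L0 eta2 q1 adm /andP[_ h1] _ xi Lxi.
have stepP t delta : time_steps T h (t, delta) ->
    [/\ 0 <= t, 0 <= t <= T, 0 < delta, delta <= 1 & t + delta <= T].
  move=> [/= /andP[t0 tT] /andP[d0 dh] tdT].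
  by split => //; [rewrite t0 ltW|exact: le_trans dh h1].
pose a t delta := pem_drift q t delta f.
pose b t delta := pem_diffusion q t delta g.
have a_lip t delta : 0 <= t <= T -> 0 < delta -> delta <= 1 ->
    exists K, forall x y, enorm (a t delta x - a t delta y) <= K * enorm (x - y).
  by move=> t_in d0 d1; eexists; exact: (pem_drift_lipschitz m0 L0 q1 adm t_in d0 d1).
have b_lip t delta : 0 <= t <= T -> 0 < delta -> delta <= 1 -> forall r,
    exists K, forall x y, enorm (b t delta r x - b t delta r y) <= K * enorm (x - y).
  by move=> t_in d0 d1 r; eexists; exact: (pem_diffusion_lipschitz L0 q1 adm t_in d0 d1 r).
have a_bounded t delta : 0 <= t <= T -> 0 < delta ->
    exists K, forall x, enorm (a t delta x) <= K.
  by move=> t_in d0; exact: (pem_drift_bounded m0 L0 q1 adm t_in d0).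
have b_bounded t delta : 0 <= t <= T -> 0 < delta -> forall r,
    exists K, forall x, enorm (b t delta r x) <= K.
  by move=> t_in d0; exact: (pem_diffusion_bounded L0 q1 adm t_in d0).
split.
  split=> // t delta /stepP[t0 t_in d0 d1 tdT] Z [mZ _].
  exact: (explicit_step_L2 filtr BM t0 d0 tdT (a_lip _ _ t_in d0 d1)
    (b_lip _ _ t_in d0 d1) (a_bounded _ _ t_in d0) (b_bounded _ _ t_in d0) mZ).
exists (2 * L + 9 * L ^+ 2), (2 * eta); split; first by lra.
move=> t delta /stepP[t0 t_in d0 d1 tdT] Y Z [mY _] [mZ _].
apply: (explicit_step_stable filtr BM t0 d0 tdT (a_lip _ _ t_in d0 d1)
  (b_lip _ _ t_in d0 d1) (a_bounded _ _ t_in d0) (b_bounded _ _ t_in d0) mY mZ).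
- by lra.
- by rewrite addr_ge0// mulr_ge0 ?(ltW d0)// addr_ge0// mulr_ge0 ?sqr_ge0// ltW.
- by move=> x y; exact: (pem_one_step_estimate m0 L0 q1 adm t_in d0 d1).
Qed.
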